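(* Let $p,q\ge 1$ and $N\ge 1$ be integers and put $n=p+q$. Let $\psi_1,\dots,\psi_n,\phi_1,\dots,\phi_n\in\mathbb{C}$ with $\mathfrak{Re}\,\phi_j<0$ for $1\le j\le p$ and $\mathfrak{Re}\,\phi_l>0$ for $p<l\le n$, and assume the numbers $e^{\mathrm{i}\psi_1},\dots,e^{\mathrm{i}\psi_n}$ are pairwise distinct. Then $$\int_{\mathrm{U}_N}\prod_{k=1}^{n}\frac{\mathrm{Det}(\mathrm{Id}_N-e^{\mathrm{i}\psi_k}u)}{\mathrm{Det}(\mathrm{Id}_N-e^{\phi_k}u)}\,du =\frac{1}{p!\,q!}\sum_{w\in \mathrm{S}_{n}}\ \prod_{l=p+1}^{n}\frac{e^{N\mathrm{i}\psi_{w(l)}}}{e^{N\phi_l}}\prod_{j=1}^{p}\frac{(1-e^{\phi_j-\mathrm{i}\psi_{w(l)}})(1-e^{\mathrm{i}\psi_{w(j)}-\phi_l})}{(1-e^{\mathrm{i}\psi_{w(j)}-\mathrm{i}\psi_{w(l)}})(1-e^{\phi_j-\phi_l})}.$$ Equivalently, for $p<l\le n$ the $l$-th factor of the integrand equals $e^{N(\mathrm{i}\psi_l-\phi_l)}\mathrm{Det}(\mathrm{Id}_N-e^{-\mathrm{i}\psi_l}\bar u)/\mathrm{Det}(\mathrm{Id}_N-e^{-\phi_l}\bar u)$, where $\bar u$ is the entrywise complex conjugate of $u$.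
   Context: $\mathrm{U}_N$ is the group of unitary $N\times N$ matrices, and $du$ is its Haar measure normalized to total mass $1$. $\mathrm{S}_n$ is the symmetric group on $\{1,\dots,n\}$, acting on indices. The terms of the sum are unchanged when $w$ is replaced by $ww'$ with $w'\in \mathrm{S}_p\times \mathrm{S}_q$ (permuting $\{1,\dots,p\}$ and $\{p+1,\dots,n\}$ separately). *)

(* Defs.v *)
From HB Require Import structures.
From mathcomp Require Import all_boot all_order all_algebra all_fingroup.
From mathcomp Require Import all_classical all_reals all_analysis.
From mathcomp Require Import complex.
Set Implicit Arguments. Unset Strict Implicit. Unset Printing Implicit Defensive.
Import Order.TTheory GRing.Theory Num.Theory.
Local Open Scope classical_set_scope.
Local Open Scope ring_scope.
Local Open Scope complex_scope.

Definition iC (R : realType) : R[i] := Complex 0 1.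
Arguments iC {R}.

Definition cexp (R : realType) (z : R[i]) : R[i] :=
  (expR (complex.Re z))%:C * ((cos (complex.Im z))%:C + iC * (sin (complex.Im z))%:C).

Definition unitary_mx (R : realType) (N : nat) (u : 'M[R[i]]_N) : Prop :=
  u *m (map_mx conjc u)^T = 1%:M.

(* R[i] is pointed (by 0), hence so are complex matrices; this is needed to
   build the generated sigma-algebra below. *)
HB.instance Definition _ (R : realType) := isPointed.Build R[i] 0.

(* The Borel sigma-algebra on complex N x N matrices (= R^(2 N^2)):
   generated by the real and imaginary parts of the entries. *)
Definition mx_gen (R : realType) (N : nat) : set (set 'M[R[i]]_N) :=
  [set S | exists (i j : 'I_N) (B : set R), measurable B /\
     (S = (fun A : 'M[R[i]]_N => complex.Re (A i j)) @^-1` B \/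
      S = (fun A : 'M[R[i]]_N => complex.Im (A i j)) @^-1` B)].

Notation MxT R N := (g_sigma_algebraType (@mx_gen R N)).

Definition haar (R : realType) (N : nat)
    (mu : probability (MxT R N) R) : Prop :=
  mu (~` [set u | unitary_mx u]) = 0%E /\
  forall (v : 'M[R[i]]_N), unitary_mx v ->
    forall A : set (MxT R N), measurable A ->
      mu ((fun u : MxT R N => v *m u) @^-1` A) = mu A.

Definition cintegral (R : realType) (N : nat)
    (mu : probability (MxT R N) R) (f : MxT R N -> R[i]) : R[i] :=
  (Rintegral mu setT (fun u => complex.Re (f u)))%:C +
  iC * (Rintegral mu setT (fun u => complex.Im (f u)))%:C.

(* Main.v *)
(** The theorem is the Heine-Szego identity (the mean of prod phi(eigenvalue)
    over U_N is the Toeplitz determinant of the Laurent coefficients of phi)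
    combined with Day's formula for Toeplitz determinants of rational symbols.

    Consider the ratio with numerator parameters a_k, k in A, and denominator
    parameters x, as a function of one x. Up to an explicit factor it is a
    polynomial of degree at most q, and at x = a_k the factor with a_k cancels,
    which leaves a ratio with one x less. Lagrange interpolation at the a_k
    therefore determines it by induction on the number of x's.

    For Toeplitz determinants the polynomiality comes from row operations: only
    the first row depends on x. For the mean of det(u)^-q times a polynomial
    in u it says that the complete homogeneous functions h_r(u), r > q,
    integrate to 0: by left invariance under the unitary maps that scale one
    line, any product of r > q entries of one row c u integrates to 0, and h_r
    is a combination of such products because it is a sum of permanents.
    Both sides of the Heine-Szego identity therefore satisfy the same
    interpolation formula when phi is a Laurent polynomial with distinct
    nonzero roots. Polynomial dependence on the roots removes the genericity,
    and rational symbols are uniform limits of Laurent polynomials, since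
    1 - x z divides 1 - (x z)^r. *)

Require Import Defs.
From HB Require Import structures.
From mathcomp Require Import all_boot all_order all_algebra all_fingroup.
From mathcomp Require Import boolp spectral.
From mathcomp Require Import ring zify.
Set Implicit Arguments. Unset Strict Implicit. Unset Printing Implicit Defensive.
Import Order.TTheory GRing.Theory Num.Theory.
Local Open Scope ring_scope.

(** * Interpolation *)

(** The number [q] enters through the parameters outside the unit disc: for |c| > 1, 1/(1 - c z) = -
    c^-1 z^-1 / (1 - c^-1 z^-1), so each of them contributes one z^-1 at every eigenvalue, which
    produces the weight det(u)^-q. The interpolation argument for the mean relies on polynomial
    integrands, so it reaches Laurent polynomial symbols only; the Toeplitz side admits rational
    symbols directly. This is why the two are compared for Laurent polynomials first. The
    approximants of a rational symbol may have repeated roots, so the comparison must hold without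
    genericity. Up to the Haar section no measure occurs: a functional [mean] over a
    [numClosedFieldType] is enough. Laurent coefficients are means of functions of det u, so no
    second integral over the circle is introduced, and averaging over |z| = 1 is replaced by the
    remark that a polynomial constant on the circle has that value at 0. The final sum over
    permutations is a sum over the images [S] of the last q indices, each counted p! q! times. *)

Section Interpolation.
Variables (K : fieldType) (I : finType) (a : I -> K) (q N : nat).
Variables (W : K -> K) (F : {set I} -> seq K -> K) (ok : K -> bool).

(** The shape of Day's formula. [W] gathers the denominator factors that stay fixed during the
    induction: it is 1 for the mean and [den_poly] for Toeplitz determinants. *)
Definition ratio_sum (A : {set I}) (xs : seq K) : K :=
  \sum_(S : {set I} | (S \subset A) && (#|S| == q))
    (\prod_(s in S) ((- a s) ^+ N * \prod_(x <- xs) (1 - x / a s))) *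
    (\prod_(t in A :\: S) W (a t)) /
    \prod_(s in S) \prod_(t in A :\: S) (1 - a t / a s).

Hypothesis a_inj : injective a.
Hypothesis a_neq0 : forall k, a k != 0.
Hypothesis F_nil : forall A : {set I}, #|A| = q -> F A [::] = \prod_(s in A) (- a s) ^+ N.
Hypothesis F_cons : forall (A : {set I}) x xs, #|A| = (q + (size xs).+1)%N -> ok x -> all ok xs ->
  exists2 P : {poly K}, (size P <= q.+1)%N /\ W x * F A (x :: xs) = P.[x] &
    forall k, k \in A -> P.[a k] = W (a k) * F (A :\ k) xs.

(** A node [a k] need not satisfy [ok], so [F] may be meaningless with [a k] as a denominator
    parameter; this is why [F_cons] provides a polynomial [P] that can still be evaluated there. The
    degree is at most [q], and [A] offers at least [q.+1] nodes. *)
Lemma ratio_interpolation (xs : seq K) (A : {set I}) :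
  #|A| = (q + size xs)%N -> all ok xs ->
  (\prod_(x <- xs) W x) * F A xs = ratio_sum A xs.
Proof.
elim: xs A => [|x xs IH] A cA.
  move=> _; rewrite addn0 in cA; rewrite big_nil mul1r F_nil // /ratio_sum (bigD1 A) /=; last first.
    by rewrite subxx cA eqxx.
  rewrite setDv [X in _ / X]big1 ?divr1; last by move=> s _; rewrite big_set0.
  rewrite big_set0 mulr1 [X in _ + X]big1 ?addr0; last first.
    move=> S /andP[/andP[sSA /eqP cS] nSA]; case/eqP: nSA.
    by apply/eqP; rewrite eqEcard sSA cS cA leqnn.
  by apply: eq_bigr => s _; rewrite big_nil mulr1.
move=> /= /andP[okx okxs].
have [P [sP FP] Pa] := F_cons cA okx okxs.
pose cf (S : {set I}) := \prod_(s in S) ((- a s) ^+ N * \prod_(x <- xs) (1 - x / a s)) *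
    (\prod_(t in A :\: S) W (a t)) /
    \prod_(s in S) \prod_(t in A :\: S) (1 - a t / a s).
pose Q := \sum_(S : {set I} | (S \subset A) && (#|S| == q))
   cf S *: \prod_(s in S) (1 - (a s)^-1 *: 'X) : {poly K}.
have QE y : Q.[y] = \sum_(S : {set I} | (S \subset A) && (#|S| == q))
   cf S * \prod_(s in S) (1 - y / a s).
  rewrite horner_sum; apply: eq_bigr => S _; rewrite hornerZ horner_prod.
  by congr (_ * _); apply: eq_bigr => s _; rewrite !hornerE mulrC.
have sQ : (size Q <= q.+1)%N.
  apply: (leq_trans (size_sum _ _ _)); apply/bigmax_leqP => S /andP[_ /eqP cS].
  apply: (leq_trans (size_scale_leq _ _)).
  apply: (leq_trans (size_prod_leq _ _)).
  rewrite leq_subLR -ltnS; have sz2 s : (size (1 - (a s)^-1 *: 'X : {poly K})%R <= 2)%N.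
    apply: (leq_trans (size_polyD _ _)); rewrite geq_max size_poly1 /= size_polyN.
    by apply: (leq_trans (size_scale_leq _ _)); rewrite size_polyX.
  apply: (@leq_ltn_trans (\sum_(s in S) 2).+1); first by rewrite ltnS; apply: leq_sum.
  by rewrite sum_nat_const cS; lia.
have root_k k : k \in A -> (\prod_(x <- xs) W x) * P.[a k] = Q.[a k].
  move=> kA; rewrite (Pa k kA) mulrCA IH //; last first.
    by move: cA; rewrite (cardsD1 k) kA /=; lia.
  (* At [a k] the subsets containing [k] acquire the factor 1 - a k / a k = 0. For the other
     subsets, [k] lies in [A :\: S], and the new factors 1 - a k / a s cancel the part of the
     denominator due to [k]. *)
  rewrite QE (bigID (fun S : {set I} => k \in S)) /= [X in X + _]big1 ?add0r; last first.
    move=> S /andP[_ kS]; rewrite (bigD1 k kS) /= divff // subrr.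
    by rewrite mul0r mulr0.
  rewrite /ratio_sum mulr_sumr.
  apply: eq_big => [S|S /andP[sSA /eqP cS]].
    by rewrite subsetD1 -andbA [in RHS]andbAC andbA.
  have /andP[sSA' kS] : (S \subset A) && (k \notin S) by rewrite -subsetD1.
  have DE : A :\: S = k |: ((A :\ k) :\: S).
    apply/setP => t; rewrite !inE; case: eqP => [->|_] /=; last by [].
    by rewrite kS kA.
  have kD : k \notin (A :\ k) :\: S by rewrite !inE eqxx /= andbF.
  rewrite /cf DE big_setU1 //=.
  under [X in _ = _ / X * _]eq_bigr do rewrite big_setU1 //=.
  rewrite [X in _ = _ / X * _]big_split /= invfM.
  have nz : \prod_(s in S) (1 - a k / a s) != 0.
    apply/prodf_neq0 => s sS; rewrite subr_eq0 eq_sym -(inj_eq (mulIf (a_neq0 s))) mul1r.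
    rewrite mulfVK // (inj_eq a_inj); apply: contraNneq kS => ->; exact: sS.
  move: (\prod_(s in S) \prod_(t in _) _)^-1 nz => c1.
  move: (\prod_(s in S) (1 - a k / a s)) => c2 nz.
  by field.
have PQ : (\prod_(x <- xs) W x) *: P = Q.
  apply/eqP; rewrite -subr_eq0; apply/eqP.
  apply: (@roots_geq_poly_eq0 _ _ [seq a k | k <- enum A]).
  - apply/allP => y /mapP[k]; rewrite mem_enum => kA ->.
    by rewrite rootE hornerD hornerN hornerZ root_k // subrr.
  - by rewrite map_inj_uniq ?enum_uniq.
  rewrite size_map -cardE cA.
  apply: leq_trans (_ : q.+1 <= _)%N; last by rewrite /=; lia.
  apply: (leq_trans (size_polyD _ _)); rewrite geq_max size_polyN sQ andbT.
  exact: (leq_trans (size_scale_leq _ _)).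
rewrite big_cons [W x * _]mulrC -mulrA FP -hornerZ PQ QE /ratio_sum.
apply: eq_bigr => S _; rewrite /cf.
under [in RHS]eq_bigr do rewrite big_cons mulrCA.
rewrite [in RHS]big_split /=; ring.
Qed.
End Interpolation.

(** * Toeplitz determinants *)

Definition toeplitz (K : pzRingType) N (c : int -> K) : 'M[K]_N :=
  \matrix_(i, j) c (i%:Z - j%:Z).

Section ToeplitzDivision.
Variables (K : comNzRingType) (N q : nat) (W : {poly K}).
Hypothesis W0 : W`_0 = 1.
Hypothesis sW : (size W <= q.+1)%N.

(* W(x) sum_r x^r c0(-j-r), truncated at degree q: beyond q its coefficients
   vanish when W annihilates the negative part of the sequence. *)
Definition border_row (c0 : int -> K) (j : nat) : {poly K} :=
  \poly_(k < q.+1) \sum_(i < k.+1) W`_i * c0 (i%:Z - k%:Z - j%:Z).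

(** The cofactors along row 0 ignore that row, so this is the Toeplitz determinant of [c0] with row
    0 replaced by [border_row]. *)
Definition border_det (c0 : int -> K) : {poly K} :=
  \sum_(j < N.+1) (cofactor (toeplitz N.+1 c0) 0 j)%:P * border_row c0 j.

Lemma size_border_det c0 : (size (border_det c0) <= q.+1)%N.
Proof.
apply: (leq_trans (size_sum _ _ _)); apply/bigmax_leqP => j _.
rewrite mul_polyC; apply: (leq_trans (size_scale_leq _ _)); exact: size_poly.
Qed.

Variables (c c0 : int -> K) (x : K).
Hypothesis c0E : forall k, c0 k = c k - x * c (k - 1).
Hypothesis Wc : forall k : nat, (q < k)%N -> \sum_(i < q.+1) W`_i * c (i%:Z - k%:Z) = 0.

(** Telescoping: by [c0E] the k-th coefficient is tau k - x tau (k+1), plus x times the coefficient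
    of [W] of index k+1 times c(-j). The first part collapses to [tau 0], the second adds (W(x) - 1)
    c(-j). *)
Lemma horner_border_row j : (border_row c0 j).[x] = W.[x] * c (- j%:Z).
Proof.
pose tau k := \sum_(i < k.+1) W`_i * c (i%:Z - k%:Z - j%:Z).
have tau0 : tau 0%N = c (- j%:Z).
  by rewrite /tau big_ord_recl big_ord0 W0 mul1r addr0 subrr sub0r.
(* The last term carries a coefficient of [W] beyond its size; the rest is [Wc] at index q.+1 +
   j. *)
have tauq : tau q.+1 = 0.
  rewrite /tau big_ord_recr /= nth_default // mul0r addr0.
  rewrite -[RHS](Wc (k := q.+1 + j)%N); last by lia.
  by apply: eq_bigr => i _; congr (_ * c _); lia.
have E k : \sum_(i < k.+1) W`_i * c0 (i%:Z - k%:Z - j%:Z) =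
   tau k - x * (tau k.+1 - W`_k.+1 * c (- j%:Z)).
  have -> : tau k.+1 = \sum_(i < k.+1) W`_i * c (i%:Z - k.+1%:Z - j%:Z) + W`_k.+1 * c (- j%:Z).
    by rewrite /tau big_ord_recr /= subrr sub0r.
  rewrite addrK mulr_sumr -sumrB.
  apply: eq_bigr => i _; rewrite c0E mulrBr [x * (_ * _)]mulrCA; congr (_ * _ - _ * (_ * c _)).
  by lia.
rewrite /border_row horner_poly.
have T n : \sum_(k < n) (\sum_(i < k.+1) W`_i * c0 (i%:Z - k%:Z - j%:Z)) * x ^+ k =
   tau 0%N - x ^+ n * tau n + (\sum_(k < n.+1) W`_k * x ^+ k - 1) * c (- j%:Z).
  elim: n => [|n IH]; first by rewrite big_ord0 big_ord_recl big_ord0 W0 /=; ring.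
  rewrite big_ord_recr /= IH E [X in _ = _ + (X - _) * _]big_ord_recr /=.
  rewrite !exprS; ring.
rewrite T tauq mulr0 subr0 tau0 (@horner_coef_wide _ q.+2) ?(leq_trans sW) //.
by ring.
Qed.

Lemma horner_border_det : (border_det c0).[x] = W.[x] * \det (toeplitz N.+1 c).
Proof.
(* Left multiplication by [L] subtracts x times the preceding row. Every row but row 0 has a
   predecessor, so only row 0 still involves [c]. *)
pose L : 'M[K]_N.+1 := \matrix_(i, j) ((i == j)%:R - x * (val i == (val j).+1)%:R).
have dL : \det L = 1.
  rewrite det_trig; first by apply: big1 => i _; rewrite mxE eqxx; case: eqP => [|_]; [lia|by rewrite mulr0 subr0].
  apply/is_trig_mxP => i j ij; rewrite mxE -val_eqE /= (ltn_eqF ij).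
  by rewrite (ltn_eqF (leqW ij)) mulr0 subr0.
have LT i j : (L *m toeplitz N.+1 c) i j =
    if i == 0 then c (- j%:Z) else toeplitz N.+1 c0 i j.
  rewrite !mxE; under eq_bigr do rewrite !mxE mulrBl.
  rewrite sumrB (bigD1 i) //= eqxx mul1r [X in _ + X - _]big1 ?addr0; last first.
    by move=> k; rewrite eq_sym => /negPf ->; rewrite mul0r.
  case: eqP => [->|/eqP i0].
    rewrite big1 ?subr0 ?sub0r // => k _.
    by rewrite mulr0 mul0r.
  have i1 : (i.-1 < N.+1)%N by case: i i0 => /= i; lia.
  have iS : (val i).-1.+1 = val i by case: i i0 {i1} => -[|i].
  rewrite (bigD1 (Ordinal i1)) //= iS eqxx [X in _ - (_ + X)]big1 ?addr0; last first.
    move=> k; rewrite -val_eqE /= => /negPf kn.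
    by case: eqP => [ik|_]; [move: kn; rewrite ik /= eqxx|by rewrite mulr0 mul0r].
  rewrite c0E mulr1; congr (_ - _ * c _); by move: iS => /=; lia.
have -> : \det (toeplitz N.+1 c) = \det (L *m toeplitz N.+1 c).
  by rewrite det_mulmx dL mul1r.
rewrite (expand_det_row _ 0) mulr_sumr horner_sum; apply: eq_bigr => j _.
have -> : cofactor (L *m toeplitz N.+1 c) 0 j = cofactor (toeplitz N.+1 c0) 0 j.
  rewrite /cofactor; congr (_ * \det _); apply/matrixP => i k.
  by rewrite [LHS]mxE [LHS]mxE LT eq_sym (negPf (neq_lift _ _)) [RHS]mxE [RHS]mxE.
by rewrite !hornerE horner_border_row LT eqxx mulrC mulrA.
Qed.
End ToeplitzDivision.

(** * Complete homogeneous functions of a matrix *)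

Section PermutationSums.
Variables (V : nmodType) (T : finType) (r : nat).

(** Here [j] is the image of 0, and [t] is what remains when 0 is deleted from its cycle.
    Injectivity of this encoding and equality of cardinals give the bijection. *)
Lemma big_perm_recl (F : 'S_r.+1 -> V) :
  \sum_s F s = \sum_(j < r.+1) \sum_(t : 'S_r) F (lift_perm 0 0 t * tperm 0 j)%g.
Proof.
rewrite pair_bigA /=.
pose h (p : 'I_r.+1 * 'S_r) := (lift_perm 0 0 p.2 * tperm 0 p.1)%g.
rewrite (reindex h) //; apply: onW_bij; apply: inj_card_bij.
  move=> [j1 t1] [j2 t2]; rewrite /h /= => e.
  have e0 := congr1 (fun s : 'S_r.+1 => s 0) e.
  rewrite !permM !lift_perm_id !tpermL in e0; rewrite e0 in e *; congr (_, _).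
  move/mulIg: e => e; apply/permP => i; apply: (@lift_inj _ 0).
  by rewrite -!(lift_perm_lift 0 0) e.
by rewrite card_prod card_ord !card_Sn factS.
Qed.

Definition fcons (t : T) (g : {ffun 'I_r -> T}) : {ffun 'I_r.+1 -> T} :=
  [ffun i => if unlift 0 i is Some k then g k else t].

Lemma fcons0 t g : fcons t g 0 = t.
Proof. by rewrite ffunE unlift_none. Qed.

Lemma fcons_lift t g i : fcons t g (lift 0 i) = g i.
Proof. by rewrite ffunE liftK. Qed.

Lemma big_ffun_recl (F : {ffun 'I_r.+1 -> T} -> V) :
  \sum_f F f = \sum_t \sum_(g : {ffun 'I_r -> T}) F (fcons t g).
Proof.
rewrite pair_bigA /=; rewrite (reindex (fun p : T * {ffun 'I_r -> T} => fcons p.1 p.2)) //.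
apply: onW_bij; exists (fun f : {ffun 'I_r.+1 -> T} => (f 0, [ffun i => f (lift 0 i)])) => [[t g]|f] /=.
  by rewrite fcons0; congr (_, _); apply/ffunP => i; rewrite ffunE fcons_lift.
by apply/ffunP => i; rewrite ffunE; case: unliftP => [k|] -> //; rewrite ffunE.
Qed.
End PermutationSums.

Section Permanent.
Variables (K : comNzRingType) (r : nat).

Definition perm_sum (M : 'I_r -> 'I_r -> K) := \sum_(s : 'S_r) \prod_t M (s t) t.

(** Inclusion-exclusion: expand the product over i of 1 + e_i, where e_i is 0 on [B] and -1 off
    [B]. *)
Lemma sum_sign_supset (B : {set 'I_r}) :
  \sum_(S : {set 'I_r} | B \subset S) (-1) ^+ #|~: S| = (B == setT)%:R :> K.
Proof.
have D : \prod_i ((i \in B)%:R : K) =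
    \sum_(S : {set 'I_r}) \prod_i (if i \in S then 1 else if i \in B then 0 else -1).
  rewrite -bigA_distr; apply: eq_bigr => i _.
  by case: (i \in B) => /=; [rewrite addr0 | rewrite subrr].
move: D.
have -> : \prod_i ((i \in B)%:R : K) = (B == setT)%:R.
  case: eqP => [->|/eqP nB]; first by apply: big1 => i _; rewrite inE.
  have [i iB] : exists i, i \notin B.
    by apply/existsP; rewrite -negb_forall; apply: contraNN nB => /forallP h; apply/eqP/setP => i; rewrite h inE.
  by rewrite (bigD1 i) //= (negPf iB) mul0r.
move=> ->; rewrite big_mkcond; apply: eq_bigr => S _.
case: ifP => [BS|/negbT /subsetPn[i iB /negPf iS]].
  rewrite [RHS](bigID (mem S)) /= [X in X * _]big1 ?mul1r; last by move=> i ->.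
  rewrite -prodr_const; apply: eq_big => i; first by rewrite inE.
  by rewrite inE => iS; rewrite (negPf iS) (contraNF (subsetP BS i)).
by rewrite (bigD1 i) //= iB iS mul0r.
Qed.

(* Ryser's formula: a permanent is a combination of products of sums of rows. *)
Lemma perm_sum_ryser (M : 'I_r -> 'I_r -> K) :
  perm_sum M = \sum_(S : {set 'I_r}) (-1) ^+ #|~: S| * \prod_t \sum_(s in S) M s t.
Proof.
under [RHS]eq_bigr => S _ do rewrite bigA_distr_big big_distrr /=.
rewrite (exchange_big_dep predT) //=.
under eq_bigr => g _.
  under eq_bigl => S.
    have -> : (g \in ffun_on (mem S)) = ([set g i | i : 'I_r] \subset S).
      apply/ffun_onP/subsetP => h => [_ /imsetP[i _ ->]|i]; [exact: h|].
      by apply: h; apply: imset_f.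
    over.
  rewrite -big_distrl /= sum_sign_supset; over.
have surjE (g : {ffun 'I_r -> 'I_r}) : ([set g i | i : 'I_r] == setT) = injectiveb g.
  apply/eqP/injectiveP => [e|g_inj].
    have /imset_injP h : #|[set g i | i : 'I_r]| == #|'I_r| by rewrite e cardsT.
    by move=> i j; apply: h.
  by apply/eqP; rewrite eqEcard subsetT cardsT card_imset /=.
under eq_bigr do rewrite surjE.
rewrite (bigID (fun g : {ffun 'I_r -> 'I_r} => injectiveb g)) /= [X in _ + X]big1 ?addr0; last first.
  by move=> g /negPf ->; rewrite mul0r.
rewrite /perm_sum [RHS](reindex (@pval _)) /=; last first.
  pose in_Sr := insubd (1%g : 'S_r).
  by exists in_Sr => /= f Uf; first apply: val_inj; apply: insubdK.
apply: eq_big => [s|s _]; first by rewrite [RHS](valP s).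
have -> : injectiveb (pval s) by exact: (valP s).
by rewrite mul1r; apply: eq_bigr => t _; rewrite pvalE.
Qed.
End Permanent.

Section SymmetricTrace.
Variables (K : comNzRingType) (N : nat) (u : 'M[K]_N).

(* [sym_trace r] is r! times the trace of u on the r-th symmetric power. *)
Definition sym_trace r := \sum_(f : {ffun 'I_r -> 'I_N}) perm_sum (fun s t => u (f s) (f t)).

(** Marking one factor by a separate matrix [A] makes the recursion on [r] close up: deleting a
    point from a cycle changes only the marked matrix. *)
Definition sym_trace_at (A : 'M[K]_N) r (k : 'I_r) :=
  \sum_(f : {ffun 'I_r -> 'I_N}) \sum_(s : 'S_r)
    \prod_t (if t == k then A else u) (f (s t)) (f t).

(** Relabel the points by the transposition of [k] and [l], which acts on [f] by composition and on
    [s] by conjugation. *)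
Lemma sym_trace_at_indep A r (k l : 'I_r) : sym_trace_at A k = sym_trace_at A l.
Proof.
pose p := tperm k l.
rewrite /sym_trace_at (reindex (fun f : {ffun 'I_r -> 'I_N} => [ffun i => f (p i)])) /=; last first.
  apply: onW_bij; exists (fun f : {ffun 'I_r -> 'I_N} => [ffun i => f (p i)]) => f;
    by apply/ffunP => i; rewrite !ffunE tpermK.
apply: eq_bigr => f _.
rewrite (reindex (fun s : 'S_r => (p * s * p)%g)) /=; last first.
  apply: onW_bij; exists (fun s : 'S_r => (p * s * p)%g) => s;
    by apply/permP => i; rewrite !permM !tpermK.
apply: eq_bigr => s _; rewrite (reindex_inj (@perm_inj _ p)) /=.
apply: eq_bigr => t _; rewrite !ffunE !permM !tpermK.
have -> // : (p t == k) = (t == l).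
by rewrite -(inj_eq (@perm_inj _ p)) tpermK tpermL.
Qed.

(* Deleting 0 from its cycle merges the factors A and u at the point j that
   0 is mapped to, which turns A into u *m A. *)
Lemma sym_trace_at0 A r : sym_trace_at A (0 : 'I_r.+1) =
  \tr A * sym_trace r + \sum_(j < r) sym_trace_at (u *m A) j.
Proof.
pose upd (g : {ffun 'I_r -> 'I_N}) j x := [ffun i => if i == j then x else g i].
rewrite /sym_trace_at big_ffun_recl.
under eq_bigr => x _ do under eq_bigr => g _ do rewrite big_perm_recl big_ord_recl.
under eq_bigr => x _ do rewrite big_split /=.
rewrite big_split /=; congr (_ + _).
  rewrite /mxtrace mulr_suml; apply: eq_bigr => x _.
  rewrite /sym_trace mulr_sumr; apply: eq_bigr => g _.
  rewrite /perm_sum mulr_sumr; apply: eq_bigr => t _.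
  rewrite big_ord_recl /= tperm1 mulg1 lift_perm_id fcons0; congr (_ * _).
  by apply: eq_bigr => i _; rewrite lift_perm_lift !fcons_lift.
under eq_bigr => x _ do rewrite exchange_big /=.
rewrite exchange_big /=; apply: eq_bigr => j _; rewrite pair_bigA /=.
(* Exchanging the values of [f] at 0 and at [j] places the inner summation index x between [u] on
   its left and [A] on its right, so that the merged factor [u *m A] sits exactly in slot [j]. *)
pose sw (p : 'I_N * {ffun 'I_r -> 'I_N}) := (p.2 j, upd p.2 j p.1).
have swK : involutive sw.
  move=> [x g]; rewrite /sw /= !ffunE eqxx; congr (_, _).
  by apply/ffunP => i; rewrite !ffunE; case: eqP => // ->.
rewrite (reindex_inj (inv_inj swK)) /=.
rewrite -(pair_bigA _ (fun x (g : {ffun 'I_r -> 'I_N}) => \sum_(t : 'S_r) \prod_i (if i == 0 then A else u)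
    (fcons (g j) (upd g j x) ((lift_perm 0 0 t * tperm 0 (lift 0 j))%g i))
    (fcons (g j) (upd g j x) i))) /= exchange_big.
apply: eq_bigr => g _ /=; rewrite exchange_big /=; apply: eq_bigr => t _ /=.
transitivity (\sum_x (u (g (t j)) x * A x (g j) * \prod_(i < r | i != j) u (g (t i)) (g i))).
  apply: eq_bigr => x _; rewrite big_ord_recl /= fcons0 permM lift_perm_id tpermL.
  rewrite fcons_lift /upd ffunE eqxx.
  rewrite (bigD1 j) //= mulrA [A _ _ * _]mulrC.
  have E i : fcons (g j) [ffun i0 => if i0 == j then x else g i0]
     ((lift_perm 0 0 t * tperm 0 (lift 0 j))%g (lift 0 i)) = g (t i).
    rewrite permM lift_perm_lift; case: (eqVneq (t i) j) => [->|tij].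
      by rewrite tpermR fcons0.
    rewrite tpermD ?fcons_lift ?ffunE ?(negPf tij) // ?(inj_eq lift_inj) //.
    by rewrite eq_sym.
  rewrite E fcons_lift ffunE eqxx; congr (_ * _); apply: eq_bigr => i /negPf ij.
  by rewrite E fcons_lift ffunE ij.
rewrite -mulr_suml [RHS](bigD1 j) //= eqxx mxE; congr (_ * _).
by apply: eq_bigr => i /negPf ->.
Qed.

Lemma sym_traceS r : sym_trace r.+1 = sym_trace_at u (0 : 'I_r.+1).
Proof.
apply: eq_bigr => f _; apply: eq_bigr => s _; apply: eq_bigr => t _.
by rewrite if_same.
Qed.

Lemma sym_trace0 : sym_trace 0 = 1.
Proof.
rewrite /sym_trace /perm_sum; under eq_bigr => f _ do under eq_bigr => s _ do rewrite big_ord0.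
by under eq_bigr => f _ do rewrite sumr_const card_Sn; rewrite sumr_const card_ffun !card_ord expn0.
Qed.
End SymmetricTrace.

Section CompleteHomogeneous.
Variables (K : numFieldType) (N : nat) (u : 'M[K]_N).

Definition hsym r : K := (r`!%:R)^-1 * sym_trace u r.

Lemma hsym0 : hsym 0 = 1.
Proof. by rewrite /hsym sym_trace0 invr1 mulr1. Qed.

Let factn0 r : r`!%:R != 0 :> K.
Proof. by rewrite pnatr_eq0 -lt0n fact_gt0. Qed.

(** The index [i] counts the other points in the cycle of the marked one. Each deletion either
    closes this cycle into a trace or multiplies [A] by one more [u], and the possible slots for the
    latter contribute equally by [sym_trace_at_indep]. *)
Lemma sym_trace_atE (A : 'M[K]_N) r (k : 'I_r.+1) :
  sym_trace_at u A k = r`!%:R * \sum_(i < r.+1) \tr (u ^+ i *m A) * hsym (r - i).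
Proof.
elim: r A k => [|r IH] A k; rewrite (sym_trace_at_indep _ _ k 0) sym_trace_at0 [in RHS]big_ord_recl /=.
  by rewrite !big_ord0 !addr0 sym_trace0 expr0 mul1mx subn0 hsym0 !mulr1 mul1r.
rewrite mulrDr; congr (_ + _).
  by rewrite expr0 mul1mx subn0 /hsym mulrCA mulVKf.
under eq_bigr do rewrite IH.
rewrite sumr_const card_ord factS natrM -mulrA -[LHS]mulr_natl.
congr (_ * (_ * _)).
apply: eq_bigr => i _; rewrite /bump /= add1n subSS.
by rewrite exprSr -mulmxE mulmxA.
Qed.

Lemma hsym_newton r : r.+1%:R * hsym r.+1 = \sum_(i < r.+1) \tr (u ^+ i.+1) * hsym (r - i).
Proof.
rewrite {1}/hsym sym_traceS sym_trace_atE factS natrM invfM.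
rewrite mulrA mulVKf ?pnatr_eq0 // mulrA mulVf // mul1r.
by apply: eq_bigr => i _; rewrite exprSr.
Qed.
End CompleteHomogeneous.

(** * Newton's identities and the inverse of the generating function of the h_r *)

Section Newton.
Variable K : numFieldType.

Lemma dvdp_Xn_coef (p : {poly K}) L i : 'X^L %| p -> (i < L)%N -> p`_i = 0.
Proof. by move=> /dvdpP[q ->] iL; rewrite coefMXn iL. Qed.

(** The logarithmic derivative of [D] is minus the generating series of the power sums; this is the
    relation cleared of its denominator and truncated at order [L]. A new factor adds the truncated
    geometric series [G]. *)
Lemma newton_prod (s : seq K) L :
  let D := \prod_(x <- s) (1 - x *: 'X) : {poly K} in
  'X^L %| D^`() + (\poly_(k < L) \sum_(x <- s) x ^+ k.+1) * D.
Proof.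
elim: s => [|x s] /=.
  rewrite big_nil -polyC1 derivC add0r mulr1.
  by under eq_poly do rewrite big_nil; rewrite poly_def big1 ?dvdp0 // => i _; rewrite scale0r.
set D := \prod_(y <- s) _; set P := \poly_(k < L) _ => IH.
rewrite big_cons -/D; set P' := \poly_(k < L) _.
pose G : {poly K} := \poly_(k < L) x ^+ k.
have P'E : P' = P + x *: G.
  apply/polyP => k; rewrite coefD coefZ !coef_poly; case: ifP => _; last by rewrite mulr0 addr0.
  by rewrite big_cons addrC exprS.
have GE : G * (1 - x *: 'X) = 1 - x ^+ L *: 'X^L.
  rewrite /G poly_def; elim: (L) => [|n IHn]; first by rewrite big_ord0 mul0r expr0 scale1r expr0 subrr.
  rewrite big_ord_recr /= mulrDl IHn !exprS -!mul_polyC !polyCM; ring.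
have -> : ((1 - x *: 'X) * D)^`() + P' * ((1 - x *: 'X) * D) =
    (1 - x *: 'X) * (D^`() + P * D) + x *: (D * (G * (1 - x *: 'X) - 1)).
  rewrite P'E derivM derivB derivZ derivX -polyC1 derivC -!mul_polyC; ring.
rewrite dvdp_add ?dvdp_mull // GE -!mul_polyC dvdp_mull // dvdp_mull //.
by rewrite addrAC subrr sub0r dvdpNr dvdp_mull.
Qed.

(** [D] and the series [H] of the h_r have opposite logarithmic derivatives, by [newton_prod] and
    [hsym_newton]. The derivative of D H therefore vanishes in low degree, and characteristic zero
    transfers this to D H itself. *)
Lemma hsym_inverse N (u : 'M[K]_N) (s : seq K) m :
  (forall k, \tr (u ^+ k.+1) = \sum_(x <- s) x ^+ k.+1) ->
  let D := \prod_(x <- s) (1 - x *: 'X) : {poly K} in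
  \sum_(i < m.+1) D`_i * hsym u (m - i) = (m == 0%N)%:R.
Proof.
move=> tru D.
have D0 : D`_0 = 1.
  rewrite -horner_coef0 horner_prod; apply: big1 => x _.
  by rewrite !hornerE ?mulr0 ?subr0.
case: m => [|m]; first by rewrite big_ord_recl big_ord0 D0 hsym0 mul1r addr0.
pose H : {poly K} := \poly_(i < m.+2) hsym u i.
pose P : {poly K} := \poly_(k < m.+1) \sum_(x <- s) x ^+ k.+1.
have DP := newton_prod s m.+1; rewrite /= -/D -/P in DP.
have HP i : (i < m.+1)%N -> (H^`() - P * H)`_i = 0.
  move=> im; rewrite coefB coef_deriv coefM coef_poly ltnS im -mulr_natl hsym_newton.
  apply/eqP; rewrite subr_eq0; apply/eqP; apply: eq_bigr => j _.
  rewrite !coef_poly tru; have ji := ltn_ord j; have -> : (j < m.+1)%N by lia.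
  by have -> : (i - j < m.+2)%N by lia.
have -> : \sum_(i < m.+2) D`_i * hsym u (m.+1 - i) = (D * H)`_m.+1.
  rewrite coefM; apply: eq_bigr => i _; rewrite coef_poly; have im := ltn_ord i.
  by have -> : (m.+1 - i < m.+2)%N by lia.
have : ((D * H)^`())`_m = 0.
  have -> : (D * H)^`() = (D^`() + P * D) * H + D * (H^`() - P * H) by rewrite derivM; ring.
  rewrite coefD !coefM !big1 ?addr0 // => i _; have im := ltn_ord i.
    by rewrite HP ?mulr0 //; lia.
  by rewrite (dvdp_Xn_coef DP) ?mul0r.
by rewrite coef_deriv => /eqP; rewrite mulrn_eq0 /= => /eqP ->.
Qed.
End Newton.

Section UnitarySpectrum.
Variables (C : numClosedFieldType) (N : nat).

(** Spectral theorem for normal matrices; the diagonal form is again unitary, which forces its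
    entries to have modulus 1. *)
Lemma unitarymx_spectrum (u : 'M[C]_N) : u \is unitarymx ->
  exists2 s : seq C, (size s = N /\ forall x, x \in s -> `|x| = 1) &
    [/\ forall c, \det (1%:M - c *: u) = \prod_(x <- s) (1 - c * x),
        \det u = \prod_(x <- s) x &
        forall k, \tr (u ^+ k) = \sum_(x <- s) x ^+ k].
Proof.
move=> uu.
have nu : u \is normalmx.
  by apply/normalmxP; move/unitarymxP: uu => uu; rewrite uu; apply/esym/mulmx1C.
have /orthomx_spectralP := nu.
move: (spectral_unitarymx u) (spectral_unit u).
move: (spectralmx u) (spectral_diag u) => V d VU uV uE.
exists [seq d 0 i | i : 'I_N].
  split; first by rewrite size_map size_enum_ord.
  move=> x /mapP[i _ ->].
  have dE : diag_mx d = V *m u *m invmx V by rewrite uE !mulmxA mulmxV // mul1mx mulmxK.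
  have : diag_mx d \is unitarymx.
    rewrite dE (invmx_unitary VU); apply: mul_unitarymx; first exact: (mul_unitarymx VU uu).
    by rewrite trmxC_unitary.
  move/unitarymxP => /(congr1 (fun A : 'M[C]_N => A i i)); rewrite !mxE (bigD1 i) //= !mxE eqxx mulr1n.
  rewrite big1 ?addr0; last by move=> j /negPf; rewrite !mxE eq_sym => ->; rewrite mulr0n mul0r.
  by rewrite -normCK => /eqP; rewrite sqrp_eq1 // => /eqP.
have det_conj (D : 'M[C]_N) : \det (invmx V *m D *m V) = \det D.
  by rewrite !det_mulmx mulrAC -det_mulmx mulVmx // det1 mul1r.
split => [c||k].
- have -> : 1%:M - c *: u = invmx V *m (1%:M - c *: diag_mx d) *m V.
    by rewrite mulmxBr mulmxBl mulmx1 mulVmx // -scalemxAr -scalemxAl -uE.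
  rewrite det_conj.
  have -> : 1%:M - c *: diag_mx d = diag_mx (\row_i (1 - c * d 0 i)).
    by apply/matrixP => i j; rewrite !mxE; case: eqP => [->|_]; rewrite ?mulr1n ?mulr0n ?mulr0 ?subr0.
  by rewrite det_diag big_map big_enum; apply: eq_bigr => i _; rewrite mxE.
- by rewrite {1}uE det_conj det_diag big_map big_enum.
have -> : u ^+ k = invmx V *m diag_mx (\row_i (d 0 i) ^+ k) *m V.
  elim: k => [|k IH].
    rewrite expr0 (_ : diag_mx _ = 1%:M) ?mulmx1 ?mulVmx //.
    by apply/matrixP => i j; rewrite !mxE expr0.
  rewrite exprSr IH -mulmxE [X in _ *m X = _]uE !mulmxA mulmxK // -[_ *m diag_mx _ *m diag_mx _]mulmxA.
  congr (_ *m _ *m _); rewrite mulmx_diag; congr diag_mx.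
  by apply/rowP => i; rewrite !mxE exprSr.
rewrite mxtrace_mulC mulmxA mulmxV // mul1mx mxtrace_diag big_map big_enum.
by apply: eq_bigr => i _; rewrite mxE.
Qed.
End UnitarySpectrum.

(** * Invariant means on polynomial functions *)

(* Integration over U_N as a functional [mean] on a class [adm] of functions;
   only the values on unitary matrices matter. *)
Record unitary_mean (C : numClosedFieldType) (N : nat) := UnitaryMean {
  adm : ('M[C]_N -> C) -> Prop;
  mean : ('M[C]_N -> C) -> C;
  adm_cst : forall c, adm (fun=> c);
  adm_entry : forall i j, adm (fun u => u i j);
  admD : forall f g, adm f -> adm g -> adm (fun u => f u + g u);
  admM : forall f g, adm f -> adm g -> adm (fun u => f u * g u);
  adm_conj : forall f, adm f -> adm (fun u => (f u)^*);
  admV : forall f e, adm f -> 0 < e -> (forall u, u \is unitarymx -> e <= `|f u|) ->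
    adm (fun u => (f u)^-1);
  adm_bounded : forall f, adm f -> exists M, forall u, u \is unitarymx -> `|f u| <= M;
  mean_ext : forall f g, (forall u, u \is unitarymx -> f u = g u) -> mean f = mean g;
  meanD : forall f g, adm f -> adm g -> mean (fun u => f u + g u) = mean f + mean g;
  meanZ : forall c f, adm f -> mean (fun u => c * f u) = c * mean f;
  mean1 : mean (fun=> 1) = 1;
  mean_left : forall v f, v \is unitarymx -> adm f -> mean (fun u => f (v *m u)) = mean f;
  mean_bound : forall f M, adm f -> (forall u, u \is unitarymx -> `|f u| <= M) ->
    `|mean f| <= 2 * M
}.

Section DetRankOne.
Variable K : comNzRingType.

(** The Weinstein-Aronszajn identity, from two block factorizations of one matrix. It computes the
    determinant of a rank-one perturbation of the identity in [det_v]. *)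
Lemma det_mulmx1D m n (A : 'M[K]_(m, n)) (B : 'M[K]_(n, m)) :
  \det (1%:M + A *m B) = \det (1%:M + B *m A).
Proof.
have e1 : block_mx 1%:M (- A) B 1%:M =
    block_mx 1%:M 0 B 1%:M *m block_mx 1%:M (- A) 0 (1%:M + B *m A).
  rewrite mulmx_block ?mul1mx ?mul0mx ?mulmx0 ?mulmx1 ?mulmxN ?addr0 ?add0r.
  by rewrite addrCA addNr addr0.
have e2 : block_mx 1%:M (- A) B 1%:M =
    block_mx (1%:M + A *m B) (- A) 0 1%:M *m block_mx 1%:M 0 B 1%:M.
  by rewrite mulmx_block ?mul1mx ?mul0mx ?mulmx0 ?mulmx1 ?mulNmx ?add0r ?addrK.
have := congr1 determinant e1; rewrite e2 !det_mulmx !det_ublock !det_lblock !det1.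
by rewrite !mulr1 !mul1r.
Qed.
End DetRankOne.

Section PolynomialFunctions.
Variables (K : comNzRingType) (N : nat).
Local Notation T := 'M[K]_N.

Inductive polyfun : (T -> K) -> Prop :=
| polyfun_cst c : polyfun (fun=> c)
| polyfun_entry i j : polyfun (fun u => u i j)
| polyfunD f g : polyfun f -> polyfun g -> polyfun (fun u => f u + g u)
| polyfunM f g : polyfun f -> polyfun g -> polyfun (fun u => f u * g u).

Lemma polyfun_ext f g : f =1 g -> polyfun f -> polyfun g.
Proof. by move/funext ->. Qed.

Lemma polyfun_sum I (s : seq I) (P : pred I) (F : I -> T -> K) :
  (forall i, polyfun (F i)) -> polyfun (fun u => \sum_(i <- s | P i) F i u).
Proof.
move=> pF; elim: s => [|i s IH].
  by apply: polyfun_ext (polyfun_cst 0) => u; rewrite big_nil.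
case Pi : (P i); last by apply: polyfun_ext IH => u; rewrite big_cons Pi.
by apply: polyfun_ext (polyfunD (pF i) IH) => u; rewrite big_cons Pi.
Qed.

Lemma polyfun_prod I (s : seq I) (P : pred I) (F : I -> T -> K) :
  (forall i, polyfun (F i)) -> polyfun (fun u => \prod_(i <- s | P i) F i u).
Proof.
move=> pF; elim: s => [|i s IH].
  by apply: polyfun_ext (polyfun_cst 1) => u; rewrite big_nil.
case Pi : (P i); last by apply: polyfun_ext IH => u; rewrite big_cons Pi.
by apply: polyfun_ext (polyfunM (pF i) IH) => u; rewrite big_cons Pi.
Qed.

Lemma polyfun_det n (F : 'I_n -> 'I_n -> T -> K) :
  (forall i j, polyfun (F i j)) -> polyfun (fun u => \det (\matrix_(i, j) F i j u)).
Proof.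
move=> pF; rewrite /determinant; apply: polyfun_sum => s.
apply: polyfunM; first exact: polyfun_cst.
apply: (@polyfun_ext (fun u => \prod_i F i (s i) u)); last exact: polyfun_prod.
by move=> u; apply: eq_bigr => i _; rewrite mxE.
Qed.

(** The degree bound is uniform in [u], so that [mean_line] can take means coefficient by
    coefficient in a finite sum. *)
Lemma polyfun_line g (A B : T) : polyfun g ->
  exists P : T -> {poly K}, [/\ forall i, polyfun (fun u => (P u)`_i),
    exists d, forall u, (size (P u) <= d)%N &
    forall u z, g (A *m u + z *: (B *m u)) = (P u).[z]].
Proof.
have pmul (D : T) i j : polyfun (fun u => (D *m u) i j).
  apply: (@polyfun_ext (fun u => \sum_k D i k * u k j)); first by move=> u; rewrite mxE.
  by apply: polyfun_sum => k; apply: polyfunM; [exact: polyfun_cst|exact: polyfun_entry].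
elim=> [c|i j|f1 f2 _ [P [Pp [d Pd] Ph]] _ [Q [Qp [e Qe] Qh]]|f1 f2 _ [P [Pp [d Pd] Ph]] _ [Q [Qp [e Qe] Qh]]].
- exists (fun=> c%:P); split=> [i||u z]; last by rewrite hornerC.
    exact: polyfun_cst.
  by exists 1%N => u; exact: size_polyC_leq1.
- exists (fun u => ((A *m u) i j)%:P + ((B *m u) i j)%:P * 'X); split=> [k||u z].
  + case: k => [|[|k]].
    * by apply: polyfun_ext (pmul A i j) => u; rewrite coefD coefC coefMX /= addr0.
    * by apply: polyfun_ext (pmul B i j) => u; rewrite coefD coefC coefMX coefC /= add0r.
    * by apply: polyfun_ext (polyfun_cst 0) => u; rewrite coefD coefC coefMX coefC /= add0r.
  + exists 2%N => u; apply: (leq_trans (size_polyD _ _)); rewrite geq_max.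
    rewrite (leq_trans (size_polyC_leq1 _)) //=.
    by rewrite mul_polyC (leq_trans (size_scale_leq _ _)) // size_polyX.
  + by rewrite !hornerE !mxE mulrC.
- exists (fun u => P u + Q u); split=> [k||u z]; last by rewrite hornerD Ph Qh.
    by apply: polyfun_ext (polyfunD (Pp k) (Qp k)) => u; rewrite coefD.
  exists (maxn d e) => u; apply: (leq_trans (size_polyD _ _)).
  by rewrite geq_max !leq_max Pd Qe orbT.
- exists (fun u => P u * Q u); split=> [k||u z]; last by rewrite hornerM Ph Qh.
    apply: (@polyfun_ext (fun u => \sum_(i < k.+1) (P u)`_i * (Q u)`_(k - i))).
      by move=> u; rewrite coefM.
    by apply: polyfun_sum => i; exact: polyfunM.
  exists (d + e)%N => u; apply: (leq_trans (size_mul_leq _ _)).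
  by have := Pd u; have := Qe u; lia.
Qed.
End PolynomialFunctions.

Section UnitCircle.
Variable C : numClosedFieldType.

(** The points are Cayley transforms (k + i)/(k - i) of natural numbers. *)
Lemma unit_circle_infinite n : exists2 s : seq C, (size s = n /\ uniq s) & forall z, z \in s -> `|z| = 1.
Proof.
pose f (k : nat) : C := (k%:R + 'i) / (k%:R - 'i).
have nz (k : nat) : (k%:R - 'i : C) != 0.
  apply/negP => /eqP h; have := congr1 (fun z : C => 'Im z) h.
  rewrite raddfB /= (Creal_ImP _ (realn _ k)) Im_i raddf0 sub0r => /eqP.
  by rewrite oppr_eq0 oner_eq0.
have finj : injective f.
  move=> k l /eqP; rewrite /f eqr_div // => /eqP h.
  have : (l%:R - k%:R) * 'i *+ 2 = 0 :> C.
    by rewrite -[RHS](subrr ((k%:R + 'i) * (l%:R - 'i))) {2}h; ring.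
  move/eqP; rewrite mulrn_eq0 /= mulf_eq0 (negPf (neq0Ci C)) orbF subr_eq0 eqr_nat eq_sym.
  by move/eqP.
exists [seq f k | k <- iota 0 n].
  by rewrite size_map size_iota map_inj_uniq // iota_uniq.
move=> z /mapP[k _ ->]; rewrite /f normrM normfV.
have -> : `|k%:R + 'i : C| = `|k%:R - 'i|.
  by rewrite -norm_conjC rmorphD /= conjC_nat conjCi.
by rewrite divff // normr_eq0.
Qed.

(** The substitute for averaging over the circle: invariance holds only for |z| = 1, but its
    polynomial consequence may be evaluated at z = 0. *)
Lemma poly_unit_const (P : {poly C}) k : (forall z, `|z| = 1 -> P.[z] = k) -> P.[0] = k.
Proof.
move=> h; have [s [ss us] hs] := unit_circle_infinite (size (P - k%:P)).
suff -> : P = k%:P by rewrite hornerC.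
apply/eqP; rewrite -subr_eq0; apply/eqP; apply: (@roots_geq_poly_eq0 _ _ s) => //.
  by apply/allP => z /hs /h; rewrite rootE hornerD hornerN hornerC => ->; rewrite subrr.
by rewrite ss.
Qed.
End UnitCircle.

Section UnitaryMeanTheory.
Variables (C : numClosedFieldType) (N : nat) (m : unitary_mean C N).
Local Notation T := 'M[C]_N.
Local Notation adm := (@adm C N m).
Local Notation mean := (@mean C N m).

Lemma adm_ext f g : f =1 g -> adm f -> adm g.
Proof. by move/funext ->. Qed.

Lemma adm_sum I (s : seq I) (P : pred I) (F : I -> T -> C) :
  (forall i, adm (F i)) -> adm (fun u => \sum_(i <- s | P i) F i u).
Proof.
move=> pF; elim: s => [|i s IH].
  by apply: adm_ext (adm_cst m 0) => u; rewrite big_nil.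
case Pi : (P i); last by apply: adm_ext IH => u; rewrite big_cons Pi.
by apply: adm_ext (admD (pF i) IH) => u; rewrite big_cons Pi.
Qed.

Lemma adm_prod I (s : seq I) (P : pred I) (F : I -> T -> C) :
  (forall i, adm (F i)) -> adm (fun u => \prod_(i <- s | P i) F i u).
Proof.
move=> pF; elim: s => [|i s IH].
  by apply: adm_ext (adm_cst m 1) => u; rewrite big_nil.
case Pi : (P i); last by apply: adm_ext IH => u; rewrite big_cons Pi.
by apply: adm_ext (admM (pF i) IH) => u; rewrite big_cons Pi.
Qed.

Lemma admX f n : adm f -> adm (fun u => f u ^+ n).
Proof.
move=> af; elim: n => [|n IH]; first by apply: adm_ext (adm_cst m 1) => u; rewrite expr0.
by apply: adm_ext (admM af IH) => u; rewrite exprS.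
Qed.

Lemma admZ c f : adm f -> adm (fun u => c * f u).
Proof. by move=> af; apply: admM => //; exact: adm_cst. Qed.

Lemma admB f g : adm f -> adm g -> adm (fun u => f u - g u).
Proof.
by move=> af ag; apply: adm_ext (admD af (admZ (-1) ag)) => u; rewrite mulN1r.
Qed.

Lemma adm_det n (F : T -> 'M[C]_n) : (forall i j, adm (fun u => F u i j)) -> adm (fun u => \det (F u)).
Proof.
move=> aF; apply: adm_sum => s; apply: admM; first exact: adm_cst.
exact: adm_prod.
Qed.

Lemma adm_polyfun g (S : T -> T) : (forall i j, adm (fun u => S u i j)) ->
  polyfun g -> adm (fun u => g (S u)).
Proof.
move=> aS; elim=> [c|i j|f1 f2 _ a1 _ a2|f1 f2 _ a1 _ a2].
- exact: adm_cst.
- exact: aS.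
- exact: admD.
- exact: admM.
Qed.

Lemma adm_poly g : polyfun g -> adm g.
Proof. by move=> pg; apply: (@adm_polyfun g id) => // i j; exact: adm_entry. Qed.

Lemma mean0 : mean (fun=> 0) = 0.
Proof.
rewrite -[RHS](mul0r (mean (fun=> 0))) -meanZ; last exact: adm_cst.
by congr mean; apply/funext => u; rewrite mul0r.
Qed.

Lemma mean_sum I (s : seq I) (F : I -> T -> C) :
  (forall i, adm (F i)) -> mean (fun u => \sum_(i <- s) F i u) = \sum_(i <- s) mean (F i).
Proof.
move=> aF; elim: s => [|i s IH].
  by rewrite big_nil -[RHS]mean0; congr mean; apply/funext => u; rewrite big_nil.
rewrite big_cons -IH -meanD //; last exact: adm_sum.
by congr mean; apply/funext => u; rewrite big_cons.
Qed.

Lemma mean_cst c : mean (fun=> c) = c.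
Proof.
rewrite -[RHS]mulr1 -(mean1 m) -meanZ; last exact: adm_cst.
by congr mean; apply/funext => u; rewrite mulr1.
Qed.

Lemma meanB f g : adm f -> adm g -> mean (fun u => f u - g u) = mean f - mean g.
Proof.
move=> af ag; rewrite -mulN1r -meanZ // -meanD //; last exact: admZ.
by congr mean; apply/funext => u; rewrite mulN1r.
Qed.

Lemma norm_det_unitary (u : T) : u \is unitarymx -> `|\det u| = 1.
Proof.
move=> /unitarymx_spectrum[s [_ s1] [_ -> _]].
by elim: s s1 => [|x s IH] s1; rewrite ?big_nil ?normr1 // big_cons normrM s1 ?mem_head // mul1r IH // => y ys; apply: s1; rewrite inE ys orbT.
Qed.

Definition detV q (u : T) : C := (\det u)^-1 ^+ q.

Lemma adm_det_id : adm (fun u => \det u).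
Proof. by apply: adm_det => i j; exact: adm_entry. Qed.

Lemma adm_detV q : adm (detV q).
Proof.
apply: admX; apply: (admV (e := 1)); [exact: adm_det_id|exact: ltr01|].
by move=> u /norm_det_unitary ->.
Qed.

Lemma mean_line (w g : T -> C) (A B : T) (S : T -> T) :
  adm w -> (forall i j, adm (fun u => S u i j)) -> polyfun g ->
  exists Q : {poly C}, forall z, mean (fun u => w u * g (A *m S u + z *: (B *m S u))) = Q.[z].
Proof.
move=> aw aS pg; have [P [Pp [d Pd] Ph]] := polyfun_line A B pg.
exists (\poly_(i < d) mean (fun u => w u * (P (S u))`_i)) => z.
have ai (i : nat) : adm (fun u => w u * (P (S u))`_i).
  by apply: admM => //; exact: (adm_polyfun aS (Pp i)).
rewrite horner_poly.
transitivity (mean (fun u => \sum_(i < d) z ^+ i * (w u * (P (S u))`_i))).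
  congr mean; apply/funext => u; rewrite Ph (horner_coef_wide _ (Pd _)) mulr_sumr.
  by apply: eq_bigr => i _; ring.
rewrite mean_sum; last by move=> i; exact: admZ.
by apply: eq_bigr => i _; rewrite meanZ // mulrC.
Qed.

Section RankOne.
Open Scope sesquilinear_scope.
Variable c : 'rV[C]_N.
Hypothesis c_neq0 : c != 0.

Let n2 : C := (c *m c^t*) 0 0.
(** The orthogonal projection onto the line of [c], acting on row vectors. Hence [v z] multiplies
    this line by z and fixes its orthogonal complement. *)
Let P : T := n2^-1 *: (c^t* *m c).

Let n2_gt0 : 0 < n2.
Proof.
rewrite /n2 mxE lt_def; apply/andP; split; last first.
  by apply: sumr_ge0 => i _; rewrite !mxE mul_conjC_ge0.
apply: contraNneq c_neq0 => e; apply/eqP/rowP => i; rewrite [RHS]mxE.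
have /eqP := e; rewrite psumr_eq0; last by move=> j _; rewrite !mxE mul_conjC_ge0.
by move=> /allP /(_ i (mem_index_enum _)); rewrite !mxE mul_conjC_eq0 => /eqP.
Qed.

Let cP : c *m P = c.
Proof.
rewrite /P -scalemxAr mulmxA [c *m _]mx11_scalar -/n2 mul_scalar_mx scalerA.
by rewrite mulVf ?scale1r // gt_eqF.
Qed.

Let PP : P *m P = P.
Proof. by rewrite {1}/P -scalemxAl -mulmxA cP. Qed.

Let PC : P^t* = P.
Proof.
have nV : (n2^-1)^* = n2^-1 by apply: conj_Creal; rewrite realV gtr0_real.
rewrite /P; apply/matrixP => i j; rewrite !mxE rmorphM; congr (_ * _); first exact: nV.
by rewrite !big_ord1 !mxE rmorphM /= conjCK mulrC.
Qed.

Let v (z : C) : T := 1%:M + (z - 1) *: P.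

Let vU z : `|z| = 1 -> v z \is unitarymx.
Proof.
move=> z1; apply/unitarymxP.
have -> : (v z)^t* = 1%:M + (z^* - 1) *: P.
  rewrite /v -{2}PC; apply/matrixP => i j; rewrite !mxE rmorphD /= rmorphM rmorphB rmorph1 /=.
  by rewrite eq_sym conjC_nat.
rewrite /v mulmxDl mul1mx mulmxDr mulmx1 -scalemxAl -scalemxAr PP; move: P => Q; rewrite scalerA -addrA -!scalerDl.
have -> : z^* - 1 + (z - 1 + (z - 1) * (z^* - 1)) = z * z^* - 1 by move: z^* => w; ring.
by rewrite -normCK z1 expr1n subrr scale0r addr0.
Qed.

Let det_v z : \det (v z) = z.
Proof.
rewrite /v /P scalerA scalemxAl det_mulmx1D det_mx11 -scalemxAr 2!mxE [X in _ + X]mxE eqxx mulr1n.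
by rewrite -/n2 mulfVK ?gt_eqF // addrC subrK.
Qed.

(* Invariance under v z, which scales the row c by z and depends polynomially on z. *)
Lemma mean_row_prod q r (j : 'I_r -> 'I_N) g : (q < r)%N -> polyfun g ->
  mean (fun u => detV q u * (\prod_t (c *m u) 0 (j t) * g u)) = 0.
Proof.
move=> qr pg; set F := (fun u => _).
pose w u := detV q u * \prod_t (c *m u) 0 (j t).
have acu k : adm (fun u => (c *m u) 0 k).
  apply: (@adm_ext (fun u : T => \sum_i c 0 i * u i k)) => [u|]; first by rewrite mxE.
  by apply: adm_sum => i; apply: admZ; exact: adm_entry.
have aw : adm w by apply: admM; [exact: adm_detV|apply: adm_prod].
have aF : adm F.
  by apply: admM; [exact: adm_detV|apply: admM; [exact: adm_prod|exact: adm_poly]].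
have [Q QE] := @mean_line w g (1%:M - P) P id aw (adm_entry m) pg.
have key z : `|z| = 1 -> mean F = z ^+ (r - q) * Q.[z].
  move=> z1; rewrite -(mean_left (vU z1) aF) -QE -meanZ; last first.
    apply: admM => //; have [P' [Pp' [d Pd] Ph]] := polyfun_line (1%:M - P) P pg.
    apply: (@adm_ext (fun u => \sum_(i < d) z ^+ i * (P' u)`_i)) => [u|].
      by rewrite Ph (horner_coef_wide _ (Pd _)); apply: eq_bigr => i _; rewrite mulrC.
    by apply: adm_sum => i; apply: admZ; exact: adm_poly.
  congr mean; apply/funext => u; rewrite /F /w.
  have z0 : z != 0 by rewrite -normr_eq0 z1 oner_eq0.
  have -> : (1%:M - P) *m u + z *: (P *m u) = v z *m u.
    by rewrite /v mulmxBl mulmxDl -scalemxAl scalerBl scale1r addrA addrAC.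
  have -> : detV q (v z *m u) = z^-1 ^+ q * detV q u.
    by rewrite /detV det_mulmx det_v invfM exprMn.
  have -> : \prod_t (c *m (v z *m u)) 0 (j t) = z ^+ r * \prod_t (c *m u) 0 (j t).
    rewrite -[r in z ^+ r]card_ord -prodr_const -big_split /=; apply: eq_bigr => t _.
    rewrite mulmxA /v mulmxDr mulmx1 -scalemxAr cP -[c in c + _]scale1r -scalerDl.
    by rewrite addrC subrK -scalemxAl mxE.
  rewrite exprVn expfB //; ring.
(* On the circle the constant [mean F] equals z^(r-q) Q(z). Since q < r, this polynomial vanishes at
   0. *)
have := @poly_unit_const C ('X^(r - q) * Q) (mean F).
rewrite hornerM hornerXn expr0n subn_eq0 leqNgt qr mul0r => <- // z /key ->.
by rewrite hornerM hornerXn.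
Qed.
End RankOne.

Lemma polyfun_hsym r : polyfun (fun u : T => hsym u r).
Proof.
apply: polyfunM; first exact: polyfun_cst.
apply: polyfun_sum => f; apply: polyfun_sum => s; apply: polyfun_prod => t.
exact: polyfun_entry.
Qed.

(** A permanent mixes different rows of [u], which no single scaling controls. Ryser's formula
    rewrites it through products of [r] entries of the one row [row f S *m u], to which
    [mean_row_prod] applies. *)
Lemma mean_hsym q r g : (q < r)%N -> polyfun g ->
  mean (fun u => detV q u * (hsym u r * g u)) = 0.
Proof.
move=> qr pg.
pose row (f : {ffun 'I_r -> 'I_N}) (S : {set 'I_r}) : 'rV[C]_N := \row_k \sum_(s in S) (f s == k)%:R.
have rowE f S (u : T) k : (row f S *m u) 0 k = \sum_(s in S) u (f s) k.
  rewrite mxE; under eq_bigr do rewrite mxE mulr_suml.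
  rewrite exchange_big /=; apply: eq_bigr => s _; rewrite (bigD1 (f s)) //= eqxx mul1r.
  by rewrite big1 ?addr0 // => i; rewrite eq_sym => /negPf ->; rewrite mul0r.
pose G (p : {ffun 'I_r -> 'I_N} * {set 'I_r}) u :=
   detV q u * (\prod_t (row p.1 p.2 *m u) 0 (p.1 t) * g u).
have aG p : adm (G p).
  apply: admM; first exact: adm_detV.
  apply: admM; last exact: adm_poly.
  apply: adm_prod => t; apply: (@adm_ext (fun u => \sum_(s in p.2) u (p.1 s) (p.1 t))) => [u|].
    by rewrite rowE.
  by apply: adm_sum => s; exact: adm_entry.
have symE u : sym_trace u r = \sum_f \sum_(S : {set 'I_r}) (-1) ^+ #|~: S| * \prod_t (row f S *m u) 0 (f t).
  apply: eq_bigr => f _; rewrite perm_sum_ryser; apply: eq_bigr => S _; congr (_ * _).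
  by apply: eq_bigr => t _; rewrite rowE.
transitivity (mean (fun u => \sum_p ((r`!%:R)^-1 * (-1) ^+ #|~: p.2|) * G p u)).
  congr mean; apply/funext => u; rewrite /hsym symE pair_bigA /= mulr_sumr mulr_suml mulr_sumr.
  by apply: eq_bigr => p _; rewrite /G; ring.
rewrite mean_sum; last by move=> p; exact: admZ.
apply: big1 => -[f S] _; rewrite meanZ // [X in _ * X](_ : _ = 0) ?mulr0 // /G /=.
have [S0|[s sS]] := set_0Vmem S.
  (* An empty [S] gives the zero row, excluded from [mean_row_prod]; the product is then zero
     because it has r > 0 factors. *)
  rewrite -[RHS]mean0; congr mean; apply/funext => u.
  have r0 : (0 < r)%N by exact: leq_ltn_trans qr.
  by rewrite (bigD1 (Ordinal r0)) //= rowE S0 big_set0 !mul0r mulr0.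
apply: mean_row_prod => //; apply/eqP => /rowP /(_ (f s)); rewrite !mxE => /eqP.
rewrite psumr_eq0; last by move=> *; exact: ler0n.
by move=> /allP /(_ s (mem_index_enum _)); rewrite sS eqxx /= oner_eq0.
Qed.

End UnitaryMeanTheory.

Lemma poly_fun_inj (C : numClosedFieldType) (P Q : {poly C}) : (forall z, P.[z] = Q.[z]) -> P = Q.
Proof.
move=> h; have [s [ss us] _] := unit_circle_infinite C (size (P - Q)).
apply/eqP; rewrite -subr_eq0; apply/eqP; apply: (@roots_geq_poly_eq0 _ _ s) => //.
  by apply/allP => z _; rewrite rootE hornerD hornerN h subrr.
by rewrite ss.
Qed.

Section MeanInterpolation.
Open Scope sesquilinear_scope.
Variables (C : numClosedFieldType) (N : nat) (m : unitary_mean C N) (q : nat).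
Local Notation T := 'M[C]_N.
Local Notation adm := (@adm C N m).
Local Notation mean := (@mean C N m).

(* The generating function of the h_r; the truncation is invisible to the mean,
   by [mean_hsym]. *)
Definition hsym_trunc (x : C) (u : T) : C := \sum_(r < q.+1) x ^+ r * hsym u r.

Lemma polyfun_hsym_trunc x : polyfun (hsym_trunc x).
Proof.
apply: polyfun_sum => r; apply: polyfunM; first exact: polyfun_cst.
exact: polyfun_hsym.
Qed.

Lemma polyfun_det1B x : polyfun (fun u : T => \det (1%:M - x *: u)).
Proof.
apply: (@polyfun_ext _ _ (fun u => \det (\matrix_(i, j) ((1%:M : T) i j + (- x) * u i j)))).
  by move=> u; congr determinant; apply/matrixP => i j; rewrite !mxE mulNr.
apply: polyfun_det => i j; apply: polyfunD; first exact: polyfun_cst.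
by apply: polyfunM; [exact: polyfun_cst|exact: polyfun_entry].
Qed.

(** The full series of the h_r would invert the determinant by [hsym_inverse]. Truncating leaves an
    error made of [hsym u r] with q < r times polynomial functions, which [mean_hsym]
    annihilates. *)
Lemma mean_cancel x g : polyfun g ->
  mean (fun u => detV q u * (\det (1%:M - x *: u) * (hsym_trunc x u * g u))) =
  mean (fun u => detV q u * g u).
Proof.
move=> pg.
have [P [Pp [d Pd] Ph]] := polyfun_line 0 1%:M (polyfun_det1B 1).
pose L := (d + q).+1.
pose B (k i : nat) u := x ^+ k * (detV q u * (hsym u (k - i) * ((P u)`_i * g u))).
have aB k i : adm (B k i).
  apply: admZ; apply: admM; first exact: adm_detV.
  apply: adm_poly; apply: polyfunM; first exact: polyfun_hsym.
  exact: polyfunM.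
have pw (u : T) : u \is unitarymx -> \det (1%:M - x *: u) * hsym_trunc x u =
   1 - \sum_(k < L) x ^+ k * \sum_(i < k.+1 | (q < k - i)%N) (P u)`_i * hsym u (k - i).
  move=> /unitarymx_spectrum[s _ [sdet _ str]].
  have PE : P u = \prod_(y <- s) (1 - y *: 'X).
    apply: poly_fun_inj => z; rewrite -Ph mul0mx add0r mul1mx scale1r sdet horner_prod.
    by apply: eq_bigr => y _; rewrite !hornerE mulrC.
  have al k := hsym_inverse k (fun j => str j.+1).
  rewrite -PE /= in al.
  pose H : {poly C} := \poly_(r < q.+1) hsym u r.
  have -> : \det (1%:M - x *: u) * hsym_trunc x u = (P u * H).[x].
    rewrite hornerM -Ph mul0mx add0r mul1mx scale1r horner_poly; congr (_ * _).
    by apply: eq_bigr => r _; rewrite mulrC.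
  have sPH : (size (P u * H)%R <= L)%N.
    apply: (leq_trans (size_mul_leq _ _)).
    have sH : (size H <= q.+1)%N by exact: size_poly.
    rewrite /L; move: (Pd u) sH; move: (size (P u)) (size H) => n1 n2; lia.
  rewrite (horner_coef_wide _ sPH).
  have cE k : (P u * H)`_k = (k == 0%N)%:R - \sum_(i < k.+1 | (q < k - i)%N) (P u)`_i * hsym u (k - i).
    rewrite -al coefM [X in X - _](bigID (fun i : 'I_k.+1 => (q < k - i)%N)) /= [RHS]addrC addKr.
    rewrite [RHS]big_mkcond /=; apply: eq_bigr => i _; rewrite coef_poly ltnS.
    by rewrite leqNgt; case: ifP => // _; rewrite mulr0.
  under eq_bigr do rewrite cE mulrBl.
  rewrite sumrB; congr (_ - _).
    by rewrite big_ord_recl /= expr0 mulr1 big1 ?addr0 // => i _; rewrite mul0r.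
  by apply: eq_bigr => i _; rewrite mulrC.
transitivity (mean (fun u => detV q u * g u - \sum_(k < L) \sum_(i < k.+1 | (q < k - i)%N) B k i u)).
  apply: mean_ext => u /pw e; rewrite [_ * (_ * g u)]mulrA e mulrBl mul1r mulrBr; congr (_ - _).
  rewrite mulr_suml mulr_sumr; apply: eq_bigr => k _.
  rewrite mulr_sumr mulr_suml mulr_sumr; apply: eq_bigr => i _.
  by rewrite /B; ring.
have aS k : adm (fun u => \sum_(i < k.+1 | (q < k - i)%N) B k i u) by exact: adm_sum.
have aSS : adm (fun u => \sum_(k < L) \sum_(i < k.+1 | (q < k - i)%N) B k i u) by exact: adm_sum.
have ag : adm (fun u => detV q u * g u) by apply: admM; [exact: adm_detV|exact: adm_poly].
rewrite (meanB ag aSS).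
rewrite [X in _ - X](_ : _ = 0) ?subr0 //; rewrite (mean_sum _ (fun k : 'I_L => aS k)); apply: big1 => k _.
transitivity (mean (fun u => \sum_(i < k.+1) (if (q < k - i)%N then B k i u else 0))).
  by congr mean; apply/funext => u; rewrite big_mkcond.
have aI (i : 'I_k.+1) : adm (fun u => if (q < k - i)%N then B k i u else 0).
  by case: (q < k - i)%N; [exact: aB|exact: adm_cst].
rewrite (mean_sum _ aI); apply: big1 => i _; case: (boolP (q < k - i)%N) => [qi|_]; last exact: mean0.
rewrite meanZ.
  by rewrite mean_hsym ?mulr0 //; apply: polyfunM.
apply: admM; first exact: adm_detV.
by apply: adm_poly; apply: polyfunM; [exact: polyfun_hsym|exact: polyfunM].
Qed.

Lemma mean_top (I : finType) (a : I -> C) (A : {set I}) : #|A| = q ->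
  mean (fun u => detV q u * \prod_(k in A) \det (1%:M - a k *: u)) = \prod_(k in A) (- a k) ^+ N.
Proof.
move=> cA; pose g (w : T) := \prod_(k in A) \det (w - (a k)%:M).
have pg : polyfun g.
  apply: polyfun_prod => k.
  apply: (@polyfun_ext _ _ (fun u => \det (\matrix_(i, j) (u i j + (- ((a k)%:M : T) i j))))).
    by move=> u; congr determinant; apply/matrixP => i j; rewrite !mxE.
  apply: polyfun_det => i j; apply: polyfunD; first exact: polyfun_entry.
  exact: polyfun_cst.
pose S (u : T) : T := u^t*.
have aS i j : adm (fun u => S u i j).
  by apply: (@adm_ext _ _ _ (fun u : T => (u j i)^*)) => [u|]; [rewrite !mxE|apply: adm_conj; exact: adm_entry].
have ag : adm (fun u => g (S u)) by exact: adm_polyfun.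
have -> : mean (fun u => detV q u * \prod_(k in A) \det (1%:M - a k *: u)) = mean (fun u => g (S u)).
  apply: mean_ext => u uU; rewrite /detV -cA -prodr_const -big_split /=; apply: eq_bigr => k _.
  have uu : S u *m u = 1%:M by apply: mulmx1C; exact/unitarymxP.
  have dS : (\det u)^-1 = \det (S u).
    apply: (mulIf (x := \det u)); first by rewrite -normr_eq0 norm_det_unitary ?oner_eq0.
    by rewrite mulVf -?det_mulmx ?uu ?det1 // -normr_eq0 norm_det_unitary ?oner_eq0.
  by rewrite dS -det_mulmx mulmxBr mulmx1 -scalemxAr uu scalemx1.
have [Q QE] := @mean_line C N m (fun=> 1) g 0 1%:M S (adm_cst m 1) aS pg.
have h z : `|z| = 1 -> Q.[z] = mean (fun u => g (S u)).
  move=> z1; have vU : (z^*)%:M \is @unitarymx C N N.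
    apply/unitarymxP; apply/matrixP => i j.
    rewrite tr_scalar_mx map_scalar_mx -scalar_mxM /= conjCK mulrC -normCK z1 expr1n.
    by [].
  rewrite -(mean_left vU ag) -QE; congr mean; apply/funext => u.
  rewrite mul1r mul0mx add0r mul1mx; congr g; apply/matrixP => i j.
  by rewrite /S mul_scalar_mx !mxE rmorphM /= conjCK.
rewrite -(poly_unit_const h) -QE -[RHS](mean_cst m); congr mean; apply/funext => u.
rewrite mul1r scale0r mul0mx addr0; apply: eq_bigr => k _.
by rewrite sub0r -raddfN det_scalar.
Qed.

Variables (I : finType) (a : I -> C).
Hypothesis a_inj : injective a.
Hypothesis a_neq0 : forall k, a k != 0.

(** The [p] zeros are dummy denominator parameters: [hsym_trunc 0] is 1, so they leave the integrand
    alone while supplying the count required by the interpolation. *)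
Lemma mean_ratio_sum (A : {set I}) p : #|A| = (q + p)%N ->
  mean (fun u => detV q u * \prod_(k in A) \det (1%:M - a k *: u)) =
  ratio_sum a q N (fun=> 1) A (nseq p 0).
Proof.
move=> cA.
pose F (A : {set I}) xs := mean (fun u => detV q u * ((\prod_(k in A) \det (1%:M - a k *: u)) *
   \prod_(x <- xs) hsym_trunc x u)).
have := @ratio_interpolation C I a q N (fun=> 1) F xpredT a_inj a_neq0 _ _ (nseq p 0) A.
rewrite big1 // mul1r => <- //.
- congr mean; apply/funext => u; rewrite [X in _ * (_ * X)]big1_seq ?mulr1 // => x.
  rewrite mem_nseq => /andP[_ /andP[_ /eqP ->]].
  rewrite /hsym_trunc big_ord_recl expr0 hsym0 mul1r big1 ?addr0 // => i _.
  by rewrite expr0n /= mul0r.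
- move=> B cB; rewrite -(mean_top a cB) /F; congr mean; apply/funext => u.
  by rewrite big_nil mulr1.
- move=> B x xs cB _ _.
  have pB (D : {set I}) : polyfun (fun u : T => \prod_(k in D) \det (1%:M - a k *: u)).
    by apply: polyfun_prod => k; exact: polyfun_det1B.
  have pxs : polyfun (fun u : T => \prod_(x <- xs) hsym_trunc x u).
    by apply: polyfun_prod => y; exact: polyfun_hsym_trunc.
  pose G r (u : T) := detV q u * ((\prod_(k in B) \det (1%:M - a k *: u)) *
     (hsym u r * \prod_(x <- xs) hsym_trunc x u)).
  have aG r : adm (G r).
    apply: admM; first exact: adm_detV.
    by apply: adm_poly; apply: polyfunM => //; apply: polyfunM => //; exact: polyfun_hsym.
  pose P := \poly_(r < q.+1) mean (G r).
  have PE y : P.[y] = mean (fun u => detV q u * ((\prod_(k in B) \det (1%:M - a k *: u)) *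
     (hsym_trunc y u * \prod_(x <- xs) hsym_trunc x u))).
    rewrite horner_poly.
    transitivity (mean (fun u => \sum_(r < q.+1) y ^+ r * G r u)).
      rewrite mean_sum; last by move=> r; exact: admZ.
      by apply: eq_bigr => r _; rewrite meanZ // mulrC.
    congr mean; apply/funext => u; rewrite /hsym_trunc mulr_suml 2!mulr_sumr.
    by apply: eq_bigr => r _; rewrite /G; ring.
  exists P.
    split; first exact: size_poly.
    by rewrite mul1r PE /F; congr mean; apply/funext => u; rewrite big_cons.
  move=> k kB; rewrite PE mul1r /F -(mean_cancel (a k) (polyfunM (pB _) pxs)).
  congr mean; apply/funext => u; rewrite (big_setD1 k kB) /=; ring.
- by rewrite size_nseq.
- exact: all_predT.
Qed.
End MeanInterpolation.

(** * Rational symbols *)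

Section CircleMean.
Open Scope sesquilinear_scope.
Variables (C : numClosedFieldType) (n : nat) (m : unitary_mean C n.+1).
(** The Archimedean property, which an abstract [numClosedFieldType] need not have; it is proved for
    [R[i]] in [complex_geom_small]. *)
Hypothesis geom_small : forall x : C, `|x| < 1 -> forall e, 0 < e -> exists k, `|x| ^+ k < e.
Local Notation T := 'M[C]_n.+1.
Local Notation adm := (@adm C n.+1 m).
Local Notation mean := (@mean C n.+1 m).

Lemma det_unitary_neq0 (u : T) : u \is unitarymx -> \det u != 0.
Proof. by move=> uU; rewrite -normr_eq0 norm_det_unitary // oner_eq0. Qed.

(** Left multiplication by a scalar of modulus 1 multiplies the integrand by z^(e k), so m z^(e k) =
    m on the circle and m = 0. The variant with the conjugate serves the inverse determinant, of
    negative degree. *)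
Lemma mean_scale_pow (w : T -> C) k e : adm w -> (0 < k)%N -> (0 < e)%N ->
  (forall z u, `|z| = 1 -> w (z *: u) = z ^+ e * w u) \/
  (forall z u, `|z| = 1 -> w (z^* *: u) = z ^+ e * w u) ->
  mean (fun u => w u ^+ k) = 0.
Proof.
move=> aw k0 e0 h; have awk : adm (fun u => w u ^+ k) by exact: admX.
have U z : `|z| = 1 -> z%:M \is @unitarymx C n.+1 n.+1.
  move=> z1; apply/unitarymxP; apply/matrixP => i j.
  by rewrite tr_scalar_mx map_scalar_mx -scalar_mxM /= -normCK z1 expr1n.
have key z : `|z| = 1 -> z ^+ (e * k) * mean (fun u => w u ^+ k) = mean (fun u => w u ^+ k).
  move=> z1; rewrite -meanZ //; case: h => h.
    rewrite -(mean_left (U _ z1) awk); congr mean; apply/funext => u.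
    by rewrite mul_scalar_mx h // exprMn exprM.
  have z1' : `|z^*| = 1 by rewrite norm_conjC.
  rewrite -(mean_left (U _ z1') awk); congr mean; apply/funext => u.
  by rewrite mul_scalar_mx h // exprMn exprM.
have := @poly_unit_const C ((mean (fun u => w u ^+ k))%:P * 'X^(e * k)) (mean (fun u => w u ^+ k)).
rewrite hornerM hornerXn hornerC expr0n muln_eq0 !gtn_eqF //= mulr0 => <- // z z1.
by rewrite hornerM hornerXn hornerC mulrC key.
Qed.

Lemma mean_det_pow k : (0 < k)%N -> mean (fun u => \det u ^+ k) = 0.
Proof.
move=> k0; apply: (@mean_scale_pow _ k n.+1) => //; first exact: adm_det_id.
by left=> z u _; rewrite detZ.
Qed.

Lemma adm_det_inv : adm (fun u => (\det u)^-1).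
Proof. exact: (adm_detV m 1). Qed.

Lemma mean_detV_pow k : (0 < k)%N -> mean (fun u => (\det u)^-1 ^+ k) = 0.
Proof.
move=> k0; apply: (@mean_scale_pow _ k n.+1) => //; first exact: adm_det_inv.
right=> z u z1; rewrite detZ invfM -exprVn; congr (_ ^+ _ * _).
have z0 : z != 0 by rewrite -normr_eq0 z1 oner_eq0.
apply: (mulfI (x := z^*)); first by rewrite conjC_eq0.
by rewrite divff ?conjC_eq0 // mulrC -normCK z1 expr1n.
Qed.

Section Analytic.
Variable w : T -> C.
Hypothesis adm_w : adm w.
Hypothesis norm_w : forall u, u \is unitarymx -> `|w u| = 1.
Hypothesis mean_w : forall k, (0 < k)%N -> mean (fun u => w u ^+ k) = 0.

Lemma one_sub_neq0 x u : `|x| < 1 -> u \is unitarymx -> 1 - x * w u != 0.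
Proof.
move=> x1 uU; rewrite subr_eq0; apply: contraTneq x1 => e.
have -> : `|x| = 1 by rewrite -(normr1 C) e normrM norm_w // mulr1.
by rewrite ltxx.
Qed.

Lemma adm_geom x : `|x| < 1 -> adm (fun u => (1 - x * w u)^-1).
Proof.
move=> x1; apply: (@admV _ _ m _ (1 - `|x|)).
- by apply: admB; [exact: adm_cst|exact: admZ].
- by rewrite subr_gt0.
move=> u uU; apply: le_trans (lerB_dist _ _).
by rewrite normr1 normrM norm_w // mulr1.
Qed.

Lemma adm_geoms xs : all (fun x => `|x| < 1) xs -> adm (fun u => \prod_(x <- xs) (1 - x * w u)^-1).
Proof.
elim: xs => [|x xs IH] /=.
  by move=> _; apply: (@adm_ext _ _ _ (fun=> 1)) => [u|]; [rewrite big_nil|exact: adm_cst].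
move=> /andP[x1 /IH axs].
by apply: adm_ext (admM (adm_geom x1) axs) => u; rewrite big_cons.
Qed.

Lemma adm_horner (p : {poly C}) : adm (fun u => p.[w u]).
Proof.
apply: (@adm_ext _ _ _ (fun u => \sum_(i < size p) p`_i * w u ^+ i)) => [u|].
  by rewrite horner_coef.
by apply: adm_sum => i; apply: admZ; exact: admX.
Qed.

Let h xs (p : {poly C}) k := mean (fun u => w u ^+ k * (p.[w u] * \prod_(x <- xs) (1 - x * w u)^-1)).

Let adm_h xs (p : {poly C}) k : all (fun x => `|x| < 1) xs ->
  adm (fun u => w u ^+ k * (p.[w u] * \prod_(x <- xs) (1 - x * w u)^-1)).
Proof.
move=> axs; apply: admM; first exact: admX.
by apply: admM; [exact: adm_horner|exact: adm_geoms].
Qed.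

Let h_cons x xs p k : `|x| < 1 -> all (fun x => `|x| < 1) xs ->
  h (x :: xs) p k = h xs p k + x * h (x :: xs) p k.+1.
Proof.
move=> x1 axs; have axxs : all (fun x => `|x| < 1) (x :: xs) by rewrite /= x1.
rewrite /h -(meanZ x (adm_h p k.+1 axxs)) -(meanD (adm_h p k axs) (admZ x (adm_h p k.+1 axxs))).
apply: mean_ext => u uU; rewrite !big_cons.
have nz := one_sub_neq0 x1 uU.
apply: (mulIf nz); rewrite exprS; set P := \prod_(_ <- _) _.
by field.
Qed.

(** No infinite series is summed. By [h_cons] and the induction hypothesis, raising the exponent by
    one costs a factor x; iterating gives h k = x^j h (k + j). These means are bounded uniformly in
    j and |x| < 1, so h k is smaller than every positive number. *)
Lemma mean_analytic_pos xs p k : all (fun x => `|x| < 1) xs -> (0 < k)%N ->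
  mean (fun u => w u ^+ k * (p.[w u] * \prod_(x <- xs) (1 - x * w u)^-1)) = 0.
Proof.
rewrite -/(h xs p k); elim: xs k => [|x xs IH] k.
  move=> _ k0; transitivity (mean (fun u => \sum_(i < size p) p`_i * w u ^+ (k + i))).
    congr mean; apply/funext => u; rewrite big_nil mulr1 horner_coef mulr_sumr.
    by apply: eq_bigr => i _; rewrite exprD mulrCA.
  rewrite mean_sum; last by move=> i; apply: admZ; exact: admX.
  apply: big1 => i _; rewrite meanZ; last exact: admX.
  by rewrite mean_w ?mulr0 // addn_gt0 k0.
move=> axxs k0; have /andP[x1 axs] := axxs.
have it j : h (x :: xs) p k = x ^+ j * h (x :: xs) p (k + j).
  elim: j => [|j ->]; first by rewrite mul1r addn0.
  by rewrite h_cons // IH ?addn_gt0 ?k0 // add0r mulrA -exprSr addnS.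
have [B hB] := adm_bounded (adm_h p 0 axxs).
have bd j : `|h (x :: xs) p j| <= 2 * B.
  apply: mean_bound; first exact: adm_h.
  by move=> u uU; rewrite normrM normrX norm_w // expr1n mul1r; have := hB u uU; rewrite expr0 mul1r.
have B0 : 0 <= 2 * B := le_trans (normr_ge0 _) (bd 0%N).
apply/eqP; rewrite -normr_le0; have : `|h (x :: xs) p k| \is Num.real by exact: normr_real.
move=> hr; rewrite real_leNgt ?real0 //; apply/negP => pos.
have B1 : 0 < 2 * B + 1 by rewrite ltr_wpDl.
have [j] := geom_small x1 (divr_gt0 pos B1).
rewrite ltr_pdivlMr // => hj; have := it j => /(congr1 (fun z => `|z|)); rewrite normrM normrX => e.
have : `|h (x :: xs) p k| < `|h (x :: xs) p k|.
  rewrite {1}e; apply: le_lt_trans hj; apply: ler_wpM2l; first exact: exprn_ge0.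
  by rewrite (le_trans (bd _)) // lerDl.
by rewrite ltxx.
Qed.

Lemma mean_analytic0 xs p : all (fun x => `|x| < 1) xs ->
  mean (fun u => p.[w u] * \prod_(x <- xs) (1 - x * w u)^-1) = p.[0].
Proof.
have -> : mean (fun u => p.[w u] * \prod_(x <- xs) (1 - x * w u)^-1) = h xs p 0.
  by congr mean; apply/funext => u; rewrite expr0 mul1r.
elim: xs => [|x xs IH] /=.
  move=> _; transitivity (mean (fun u => \sum_(i < size p) p`_i * w u ^+ i)).
    by congr mean; apply/funext => u; rewrite big_nil mul1r mulr1 horner_coef.
  rewrite mean_sum; last by move=> i; apply: admZ; exact: admX.
  rewrite horner_coef; apply: eq_bigr => i _; rewrite meanZ; last exact: admX.
  case: (posnP i) => [->|i0]; last by rewrite mean_w // expr0n gtn_eqF.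
  by rewrite !expr0 mean1.
move=> /andP[x1 axs]; rewrite h_cons // IH // /h mean_analytic_pos ?mulr0 ?addr0 //.
by rewrite /= x1.
Qed.
End Analytic.
End CircleMean.

Section Symbol.
Variables (C : numClosedFieldType) (n : nat) (m : unitary_mean C n.+1).
Hypothesis geom_small : forall x : C, `|x| < 1 -> forall e, 0 < e -> exists k, `|x| ^+ k < e.
Local Notation T := 'M[C]_n.+1.
Local Notation adm := (@adm C n.+1 m).
Local Notation mean := (@mean C n.+1 m).
Local Notation small := (fun x : C => `|x| < 1).

Lemma norm_detV (u : T) : u \is unitarymx -> `|(\det u)^-1| = 1.
Proof. by move=> uU; rewrite normfV norm_det_unitary // invr1. Qed.

Lemma adm_det_exprz (k : int) : adm (fun u => \det u ^ k).
Proof.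
case: k => k; first exact: admX (adm_det_id m).
apply: (@adm_ext _ _ _ (fun u => (\det u)^-1 ^+ k.+1)) => [u|]; first by rewrite exprVn.
by apply: admX; exact: adm_det_inv.
Qed.

Variables (I : finType) (q : nat) (ys : seq C).
Hypothesis ys_small : all small ys.
Hypothesis size_ys : (size ys <= q)%N.

Section Coefficients.
Variable a : I -> C.

Definition symbol (A : {set I}) (xs : seq C) (z : C) : C :=
  z ^ (- q%:Z) * \prod_(k in A) (1 - a k * z) * \prod_(x <- xs) (1 - x * z)^-1 *
  \prod_(y <- ys) (1 - y * z^-1)^-1.

(* Laurent coefficients, as integrals against the law of the determinant,
   which is uniform on the unit circle. *)
Definition symbol_coef (A : {set I}) (xs : seq C) (k : int) : C :=
  mean (fun u => symbol A xs (\det u) * \det u ^ (- k)).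

Lemma adm_symbol A xs : all small xs -> adm (fun u => symbol A xs (\det u)).
Proof.
move=> axs; apply: admM; last first.
  by apply: (adm_geoms (w := fun u => (\det u)^-1)) => //; [exact: adm_det_inv|exact: norm_detV].
apply: admM; last by apply: (adm_geoms (adm_det_id m)) => // u; exact: norm_det_unitary.
apply: admM; first exact: adm_det_exprz.
apply: adm_prod => k; apply: admB; first exact: adm_cst.
by apply: admZ; exact: adm_det_id.
Qed.

Lemma adm_symbol_pow A xs k : all small xs -> adm (fun u => symbol A xs (\det u) * \det u ^ k).
Proof. by move=> axs; apply: admM; [exact: adm_symbol|exact: adm_det_exprz]. Qed.

Lemma symbol_coef_cons A x xs k : small x -> all small xs ->
  symbol_coef A xs k = symbol_coef A (x :: xs) k - x * symbol_coef A (x :: xs) (k - 1).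
Proof.
move=> x1 axs; have axxs : all small (x :: xs) by rewrite /= x1.
rewrite /symbol_coef -(meanZ x (adm_symbol_pow A _ axxs)).
rewrite -(meanB (adm_symbol_pow A _ axxs) (admZ x (adm_symbol_pow A _ axxs))).
apply: mean_ext => u uU; rewrite /symbol big_cons.
have nz : 1 - x * \det u != 0.
  by apply: (one_sub_neq0 (w := fun u => \det u)) => // v; exact: norm_det_unitary.
have d0 := det_unitary_neq0 uU.
have -> : - (k - 1) = - k + 1 by ring.
rewrite expfzDr // expr1z.
move: (\prod_(_ <- xs) _) (\prod_(_ <- ys) _) (\prod_(_ in A) _) (_ ^ (- q%:Z)) (_ ^ (- k)) => p1 p2 p3 p4 p5.
by field.
Qed.

Lemma symbol_coef_setD (A : {set I}) xs k j : all small xs -> k \in A ->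
  symbol_coef A xs j = symbol_coef (A :\ k) xs j - a k * symbol_coef (A :\ k) xs (j - 1).
Proof.
move=> axs kA; rewrite /symbol_coef -(meanZ _ (adm_symbol_pow _ _ axs)).
rewrite -(meanB (adm_symbol_pow _ _ axs) (admZ _ (adm_symbol_pow _ _ axs))).
apply: mean_ext => u uU; rewrite /symbol (big_setD1 k kA) /=.
have d0 := det_unitary_neq0 uU.
have -> : - (j - 1) = - j + 1 by ring.
by rewrite expfzDr // expr1z; ring.
Qed.

Definition den_poly : {poly C} := \prod_(y <- ys) (1 - y *: 'X).

Lemma den_polyE z : den_poly.[z] = \prod_(y <- ys) (1 - y * z).
Proof. by rewrite horner_prod; apply: eq_bigr => y _; rewrite !hornerE. Qed.

Lemma size_den_poly : (size den_poly <= q.+1)%N.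
Proof.
apply: (@leq_trans (size ys).+1); last by rewrite ltnS.
rewrite /den_poly; elim: (ys) => [|y s IH]; first by rewrite big_nil size_poly1.
rewrite big_cons; apply: (leq_trans (size_mul_leq _ _)).
have : (size (1 - y *: 'X : {poly C})%R <= 2)%N.
  apply: (leq_trans (size_polyD _ _)); rewrite geq_max size_poly1 /= size_polyN.
  by apply: (leq_trans (size_scale_leq _ _)); rewrite size_polyX.
by move: IH => /=; move: (size _) (size _) => n1 n2; lia.
Qed.

Lemma den_poly0 : den_poly`_0 = 1.
Proof.
rewrite -horner_coef0 den_polyE; apply: big1_seq => y _.
by rewrite mulr0 subr0.
Qed.

(** The sum is the Laurent coefficient of index -k of [den_poly] at z^-1 times the symbol. That
    product has no factor 1 - y/z left, so it is z^-q times a function analytic in the disc, and -k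
    < -q. *)
Lemma symbol_coef_den A xs k : all small xs -> (q < k)%N ->
  \sum_(i < q.+1) den_poly`_i * symbol_coef A xs (i%:Z - k%:Z) = 0.
Proof.
move=> axs qk; rewrite /symbol_coef.
transitivity (mean (fun u => \sum_(i < q.+1) den_poly`_i * (symbol A xs (\det u) * \det u ^ (- (i%:Z - k%:Z))))).
  rewrite mean_sum; last by move=> i; apply: admZ; exact: adm_symbol_pow.
  by apply: eq_bigr => i _; rewrite meanZ //; exact: adm_symbol_pow.
pose p : {poly C} := \prod_(k in A) (1 - a k *: 'X).
have pE z : p.[z] = \prod_(k in A) (1 - a k * z).
  by rewrite horner_prod; apply: eq_bigr => i _; rewrite !hornerE.
rewrite -[RHS](@mean_analytic_pos _ _ _ geom_small (fun u => \det u) (adm_det_id m) (@norm_det_unitary _ _)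
  (@mean_det_pow _ _ m) xs p (k - q)) ?subn_gt0 //.
apply: mean_ext => u uU; have d0 := det_unitary_neq0 uU.
transitivity (symbol A xs (\det u) * (den_poly.[(\det u)^-1] * \det u ^+ k)).
  rewrite (horner_coef_wide _ size_den_poly) mulr_suml mulr_sumr; apply: eq_bigr => i _.
  rewrite opprB expfzDr // -exprnP exprVn -exprnN; ring.
have nz : \prod_(y <- ys) (1 - y * (\det u)^-1) != 0.
  rewrite prodf_seq_neq0; apply/allP => y yin /=.
  apply: (one_sub_neq0 (w := fun u => (\det u)^-1)) uU; first exact: norm_detV.
  exact: (allP ys_small).
have kq : (k - q)%:Z = k%:Z - q%:Z by lia.
rewrite den_polyE /symbol pE [\det u ^+ (k - q)]exprnP kq expfzDr // [\prod_(y <- ys) (1 - _)^-1]prodfV -exprnP.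
move: nz; move: (\prod_(_ <- ys) _) (\prod_(_ <- xs) _) (\prod_(_ in A) _) => p1 p2 p3 nz.
by field.
Qed.

Definition symbol_toeplitz A xs : 'M[C]_n.+1 := toeplitz n.+1 (symbol_coef A xs).

(** With [q] numerators, z^-q turns the factors 1 - a z into z^-1 - a. The symbol is then analytic
    in z^-1, the matrix is upper triangular, and the diagonal entry is the value at z^-1 = 0. *)
Lemma det_symbol_toeplitz_nil (A : {set I}) : #|A| = q ->
  \det (symbol_toeplitz A [::]) = \prod_(k in A) (- a k) ^+ n.+1.
Proof.
move=> cA; pose p : {poly C} := \prod_(k in A) ('X - (a k)%:P).
have pE z : p.[z] = \prod_(k in A) (z - a k).
  by rewrite horner_prod; apply: eq_bigr => i _; rewrite !hornerE.
have cE (k : nat) : symbol_coef A [::] k%:Z =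
    mean (fun u => (\det u)^-1 ^+ k * (p.[(\det u)^-1] * \prod_(y <- ys) (1 - y * (\det u)^-1)^-1)).
  apply: mean_ext => u uU; have d0 := det_unitary_neq0 uU.
  have eN (j : nat) : \det u ^ (- j%:Z) = (\det u)^-1 ^+ j by rewrite -exprnN exprVn.
  rewrite /symbol big_nil mulr1 pE !eN [RHS]mulrC; congr (_ * _ * _).
  rewrite -cA -prodr_const -big_split; apply: eq_bigr => k' _ /=.
  by rewrite mulrBr mulr1 mulrCA mulVf // mulr1.
have c0 : symbol_coef A [::] 0 = \prod_(k in A) (- a k).
  rewrite (cE 0%N) -[RHS](_ : p.[0] = _); last by rewrite pE; apply: eq_bigr => k _; rewrite sub0r.
  rewrite -(mean_analytic0 geom_small (adm_det_inv m) norm_detV (@mean_detV_pow _ _ m) p ys_small).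
  by congr mean; apply/funext => u; rewrite expr0 mul1r.
have cpos (k : nat) : (0 < k)%N -> symbol_coef A [::] k%:Z = 0.
  by move=> k0; rewrite cE; exact: (mean_analytic_pos geom_small (adm_det_inv m) norm_detV (@mean_detV_pow _ _ m)).
rewrite /symbol_toeplitz /toeplitz -det_tr det_trig; last first.
  apply/is_trig_mxP => i j ij; rewrite !mxE.
  have -> : j%:Z - i%:Z = (j - i)%N%:Z by lia.
  by rewrite cpos // subn_gt0.
transitivity (\prod_(i < n.+1) \prod_(k in A) (- a k)).
  by apply: eq_bigr => i _; rewrite !mxE subrr c0.
by rewrite prodr_const card_ord prodrXl.
Qed.

Hypothesis a_inj : injective a.
Hypothesis a_neq0 : forall k, a k != 0.

Lemma toeplitz_ratio_sum (A : {set I}) xs : #|A| = (q + size xs)%N -> all small xs ->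
  (\prod_(x <- xs) den_poly.[x]) * \det (symbol_toeplitz A xs) =
  ratio_sum a q n.+1 (fun x => den_poly.[x]) A xs.
Proof.
move=> cA axs.
apply: (@ratio_interpolation C I a q n.+1 (fun x => den_poly.[x])
  (fun A xs => \det (symbol_toeplitz A xs)) small) => //; first exact: det_symbol_toeplitz_nil.
move=> {cA axs} {}A x {}xs _ x1 axs.
have axxs : all small (x :: xs) by rewrite /= x1.
(* One polynomial serves both conditions. Adding the denominator parameter x and removing the
   numerator [a k] are both divisions of the same symbol by a linear factor, hence two instances of
   [horner_border_det]. *)
exists (border_det n q den_poly (symbol_coef A xs)).
  split; first exact: size_border_det.
  apply/esym; apply: (horner_border_det n den_poly0 size_den_poly) => k.
    exact: symbol_coef_cons.
  exact: symbol_coef_den.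
move=> k kA; apply: (horner_border_det n den_poly0 size_den_poly) => j.
  exact: symbol_coef_setD.
exact: symbol_coef_den.
Qed.
End Coefficients.
End Symbol.

Section PolynomialFamilies.
Variables (C : numClosedFieldType) (N : nat) (m : unitary_mean C N).
Local Notation T := 'M[C]_N.
Local Notation adm := (@adm C N m).
Local Notation mean := (@mean C N m).

(** The coefficients are only admissible, not polynomial functions of [u], so that negative powers
    of the determinant are allowed. *)
Definition polyfam (F : C -> T -> C) := exists P : T -> {poly C},
  [/\ forall i, adm (fun u => (P u)`_i), exists d, forall u, (size (P u) <= d)%N &
      forall z u, F z u = (P u).[z]].

Lemma polyfam_ext F G : (forall z u, F z u = G z u) -> polyfam F -> polyfam G.
Proof. by move=> FG [P [aP dP hP]]; exists P; split=> // z u; rewrite -FG. Qed.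

Lemma polyfam_cst f : adm f -> polyfam (fun _ u => f u).
Proof.
move=> af; exists (fun u => (f u)%:P); split=> [i||z u]; last by rewrite hornerC.
  case: i => [|i]; first by apply: adm_ext af => u; rewrite coefC.
  by apply: adm_ext (adm_cst m 0) => u; rewrite coefC.
by exists 1%N => u; exact: size_polyC_leq1.
Qed.

Lemma polyfam_var : polyfam (fun z _ => z).
Proof.
exists (fun=> 'X); split=> [i||z u]; [exact: adm_cst| |by rewrite hornerX].
by exists 2%N => u; rewrite size_polyX.
Qed.

Lemma polyfamD F G : polyfam F -> polyfam G -> polyfam (fun z u => F z u + G z u).
Proof.
move=> [P [aP [d dP] hP]] [Q [aQ [e dQ] hQ]]; exists (fun u => P u + Q u).
split=> [i||z u]; last by rewrite hornerD hP hQ.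
  by apply: adm_ext (admD (aP i) (aQ i)) => u; rewrite coefD.
exists (maxn d e) => u; apply: (leq_trans (size_polyD _ _)).
by rewrite geq_max !leq_max dP dQ orbT.
Qed.

Lemma polyfamM F G : polyfam F -> polyfam G -> polyfam (fun z u => F z u * G z u).
Proof.
move=> [P [aP [d dP] hP]] [Q [aQ [e dQ] hQ]]; exists (fun u => P u * Q u).
split=> [i||z u]; last by rewrite hornerM hP hQ.
  apply: (@adm_ext _ _ _ (fun u => \sum_(j < i.+1) (P u)`_j * (Q u)`_(i - j))) => [u|].
    by rewrite coefM.
  by apply: adm_sum => j; exact: admM.
exists (d + e)%N => u; apply: (leq_trans (size_mul_leq _ _)).
by have := dP u; have := dQ u; lia.
Qed.

Lemma polyfam_sum I (s : seq I) (P : pred I) (F : I -> C -> T -> C) :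
  (forall i, polyfam (F i)) -> polyfam (fun z u => \sum_(i <- s | P i) F i z u).
Proof.
move=> pF; elim: s => [|i s IH].
  by apply: polyfam_ext (polyfam_cst (adm_cst m 0)) => z u; rewrite big_nil.
case Pi : (P i); last by apply: polyfam_ext IH => z u; rewrite big_cons Pi.
by apply: polyfam_ext (polyfamD (pF i) IH) => z u; rewrite big_cons Pi.
Qed.

Lemma polyfam_prod I (s : seq I) (P : pred I) (F : I -> C -> T -> C) :
  (forall i, polyfam (F i)) -> polyfam (fun z u => \prod_(i <- s | P i) F i z u).
Proof.
move=> pF; elim: s => [|i s IH].
  by apply: polyfam_ext (polyfam_cst (adm_cst m 1)) => z u; rewrite big_nil.
case Pi : (P i); last by apply: polyfam_ext IH => z u; rewrite big_cons Pi.
by apply: polyfam_ext (polyfamM (pF i) IH) => z u; rewrite big_cons Pi.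
Qed.

Lemma polyfam_det k (F : C -> T -> 'M[C]_k) :
  (forall i j, polyfam (fun z u => F z u i j)) -> polyfam (fun z u => \det (F z u)).
Proof.
move=> pF; apply: polyfam_sum => s; apply: polyfamM; last exact: polyfam_prod.
by apply: polyfam_cst; exact: adm_cst.
Qed.

Lemma polyfam_line a b f : adm f -> polyfam (fun z u => 1 - (a + z * b) * f u).
Proof.
move=> af; apply: (@polyfam_ext (fun z u => (1 - a * f u) + z * (- b * f u))) => [z u|].
  ring.
apply: polyfamD; first by apply: polyfam_cst; apply: admB; [exact: adm_cst|exact: admZ].
by apply: polyfamM; [exact: polyfam_var|apply: polyfam_cst; exact: admZ].
Qed.

Lemma mean_polyfam F : polyfam F -> exists Q : {poly C}, forall z, mean (F z) = Q.[z].
Proof.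
move=> [P [aP [d dP] hP]]; exists (\poly_(i < d) mean (fun u => (P u)`_i)) => z.
rewrite horner_poly.
transitivity (mean (fun u => \sum_(i < d) z ^+ i * (P u)`_i)).
  congr mean; apply/funext => u; rewrite hP (horner_coef_wide _ (dP _)).
  by apply: eq_bigr => i _; rewrite mulrC.
rewrite mean_sum; last by move=> i; apply: admZ.
by apply: eq_bigr => i _; rewrite meanZ // mulrC.
Qed.
End PolynomialFamilies.

Section HeineSzego.
Variables (C : numClosedFieldType) (n : nat) (m : unitary_mean C n.+1).
Hypothesis geom_small : forall x : C, `|x| < 1 -> forall e, 0 < e -> exists k, `|x| ^+ k < e.
Variables (I : finType) (q : nat).
Hypothesis qI : (q <= #|I|)%N.
Local Notation T := 'M[C]_n.+1.
Local Notation adm := (@adm C n.+1 m).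
Local Notation mean := (@mean C n.+1 m).

Let lhs (a : I -> C) := mean (fun u => detV q u * \prod_k \det (1%:M - a k *: u)).
Let rhs (a : I -> C) := \det (toeplitz n.+1 (fun k =>
  mean (fun u => \det u ^ (- q%:Z - k) * \prod_i (1 - a i * \det u)))).

(** With [ys] empty, [den_poly] is 1, and with all [xs] zero the symbol is the Laurent polynomial
    itself. Both sides are then the same [ratio_sum]. *)
Let heine_szego_generic a : injective a -> (forall k, a k != 0) -> lhs a = rhs a.
Proof.
move=> a_inj a0; pose p := (#|I| - q)%N.
have cA : #|[set: I]| = (q + p)%N by rewrite cardsT /p subnKC.
have := mean_ratio_sum m a_inj a0 cA.
have small0 : all (fun x : C => `|x| < 1) (nseq p 0).
  by apply/allP => x; rewrite mem_nseq => /andP[_ /eqP ->]; rewrite normr0 ltr01.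
have := @toeplitz_ratio_sum C n m geom_small I q [::] isT (leq0n q) a a_inj a0 setT (nseq p 0).
rewrite size_nseq => /(_ cA small0).
have den1 x : (den_poly [::] : {poly C}).[x] = 1 by rewrite den_polyE big_nil.
rewrite big1 ?mul1r //; have -> : (fun x : C => (den_poly [::] : {poly C}).[x]) = (fun=> 1).
  by apply/funext => x; rewrite den1.
move=> <- e; rewrite /lhs /rhs; transitivity (mean (fun u => detV q u * \prod_(k in [set: I]) \det (1%:M - a k *: u))).
  by congr mean; apply/funext => u; congr (_ * _); apply: eq_bigl => k; rewrite inE.
rewrite e; congr determinant; apply/matrixP => i j; rewrite !mxE /symbol_coef.
apply: mean_ext => u uU; have d0 := det_unitary_neq0 uU.
rewrite /symbol big_nil mulr1 [\prod_(x <- nseq _ _) _]big1_seq ?mulr1; last first.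
  by move=> x; rewrite mem_nseq => /andP[_ /andP[_ /eqP ->]]; rewrite mul0r subr0 invr1.
rewrite mulrAC -expfzDr //; congr (_ * _).
by apply: eq_bigl => k; rewrite inE.
Qed.

Lemma heine_szego a : lhs a = rhs a.
Proof.
(* Distinct nonzero slopes: on the line [ae z] through [a], all but finitely many points have
   distinct nonzero coordinates. Both sides are polynomials in z, so the identity extends to z =
   0. *)
pose b (k : I) : C := (enum_rank k).+1%:R.
have b_inj : injective b.
  by move=> k l /eqP; rewrite eqr_nat eqSS => /eqP/ord_inj/enum_rank_inj.
have b0 k : b k != 0 by rewrite pnatr_eq0.
pose ae z k := a k + z * b k.
have [Q1 Q1E] : exists Q : {poly C}, forall z, lhs (ae z) = Q.[z].
  apply: mean_polyfam; apply: polyfamM; first by apply: polyfam_cst; exact: adm_detV.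
  apply: polyfam_prod => k; apply: polyfam_det => i j.
  apply: (@polyfam_ext _ _ _ (fun z u => (1%:M - a k *: u) i j + z * (- b k * u i j))) => [z u|].
    rewrite !mxE /ae; move: (_%:R) (u i j) => e w; ring.
  apply: polyfamD.
    apply: polyfam_cst; apply: (@adm_ext _ _ _ (fun u : T => (1%:M : T) i j - a k * u i j)) => [u|].
      by rewrite !mxE.
    by apply: admB; [exact: adm_cst|apply: admZ; exact: adm_entry].
  by apply: polyfamM; [exact: polyfam_var|apply: polyfam_cst; apply: admZ; exact: adm_entry].
have Qc (k : int) : exists Q : {poly C}, forall z,
    mean (fun u => \det u ^ (- q%:Z - k) * \prod_i (1 - ae z i * \det u)) = Q.[z].
  apply: mean_polyfam; apply: polyfamM; first by apply: polyfam_cst; exact: adm_det_exprz.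
  by apply: polyfam_prod => i; apply: polyfam_line; exact: adm_det_id.
have [Qk QkE] := choice Qc.
pose Q2 := \det (toeplitz n.+1 Qk).
have Q2E z : rhs (ae z) = Q2.[z].
  rewrite /Q2 -horner_evalE -det_map_mx; congr determinant; apply/matrixP => i j.
  by rewrite !mxE /= horner_evalE QkE.
(* [D1] vanishes where some coordinate is 0 and [D2] where two coincide. Multiplying the difference
   by [D1 * D2] makes it vanish everywhere. *)
pose D1 : {poly C} := \prod_k ((a k)%:P + b k *: 'X).
pose D2 : {poly C} := \prod_k \prod_(l | l != k) ((a k - a l)%:P + (b k - b l) *: 'X).
have lin_neq0 (x y : C) : y != 0 -> x%:P + y *: 'X != 0 :> {poly C}.
  apply: contraNneq => e; have := congr1 (fun P : {poly C} => P`_1) e.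
  by rewrite coefD coefC coefZ coefX coef0 /= add0r mulr1 => ->.
have D0 : D1 * D2 != 0.
  rewrite mulf_neq0 //; first by apply/prodf_neq0 => k _; exact: lin_neq0.
  apply/prodf_neq0 => k _; apply/prodf_neq0 => l lk; apply: lin_neq0.
  by rewrite subr_eq0 (inj_eq b_inj) eq_sym.
have : (Q1 - Q2) * (D1 * D2) = 0.
  apply: poly_fun_inj => z; rewrite horner0 hornerM.
  have [D12|D12] := eqVneq (D1 * D2).[z] 0; first by rewrite D12 mulr0.
  move: D12; rewrite hornerM mulf_eq0 negb_or !horner_prod => /andP[/prodf_neq0 h1 /prodf_neq0 h2].
  rewrite hornerD hornerN -Q1E -Q2E heine_szego_generic ?subrr ?mul0r //.
    move=> k l e; apply/eqP; apply: contraT => kl; have := h2 k isT.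
    rewrite horner_prod => /prodf_neq0 /(_ l); rewrite eq_sym kl => /(_ isT).
    rewrite !hornerE; have -> : a k - a l + (b k - b l) * z = ae z k - ae z l by rewrite /ae; ring.
    by rewrite e subrr eqxx.
  by move=> k; have := h1 k isT; rewrite !hornerE mulrC.
move/eqP; rewrite mulf_eq0 (negPf D0) orbF subr_eq0 => /eqP Q12.
have ae0 : ae 0 = a by apply/funext => k; rewrite /ae mul0r addr0.
by rewrite -ae0 Q1E Q12 Q2E.
Qed.
End HeineSzego.

(** * Passage to the limit *)

Section UniformConvergence.
Variables (C : numClosedFieldType) (X : Type) (D : X -> Prop).

(** Convergence of numbers is the case where [X] is [unit], which lets sums, products and
    determinants share the same lemmas. *)
Definition ucv (F : nat -> X -> C) (f : X -> C) :=
  forall e, 0 < e -> exists K, forall r x, (K <= r)%N -> D x -> `|F r x - f x| <= e.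

Definition bounded (f : X -> C) := exists2 M, 0 <= M & forall x, D x -> `|f x| <= M.

Lemma ucv_cst f : ucv (fun=> f) f.
Proof. by move=> e e0; exists 0%N => r x _ _; rewrite subrr normr0 ltW. Qed.

Lemma bounded_cst c : bounded (fun=> c).
Proof. by exists `|c|. Qed.

Lemma ucvD F G f g : ucv F f -> ucv G g -> ucv (fun r x => F r x + G r x) (fun x => f x + g x).
Proof.
move=> cF cG e e0; have e20 : 0 < e / 2 by rewrite divr_gt0.
have [K1 h1] := cF _ e20; have [K2 h2] := cG _ e20.
exists (maxn K1 K2) => r x; rewrite geq_max => /andP[k1 k2] Dx.
rewrite opprD addrACA (le_trans (ler_normD _ _)) // [leRHS](splitr e).
by rewrite lerD ?h1 ?h2.
Qed.

Lemma ucvM F G f g : ucv F f -> ucv G g -> bounded f -> bounded g ->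
  ucv (fun r x => F r x * G r x) (fun x => f x * g x).
Proof.
move=> cF cG [M M0 fM] [L L0 gL] e e0.
have S0 : 0 < M + L + 1 by rewrite ltr_wpDl ?addr_ge0.
(* The factor e + 1 secures d <= 1 and d (M + L + 1) <= e at once, without taking a minimum. *)
pose d := e / ((M + L + 1) * (e + 1)).
have e1 : 0 < e + 1 by rewrite addr_gt0.
have d0 : 0 < d by rewrite divr_gt0 // mulr_gt0.
have [K1 h1] := cF _ d0; have [K2 h2] := cG _ d0.
exists (maxn K1 K2) => r x; rewrite geq_max => /andP[k1 k2] Dx.
have -> : F r x * G r x - f x * g x =
  (F r x - f x) * (G r x - g x) + (F r x - f x) * g x + f x * (G r x - g x) by ring.
have dE : d * d + d * L + M * d <= e.
  have d1 : d <= 1.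
    rewrite /d ler_pdivrMr ?mul1r ?mulr_gt0 //; apply: (@le_trans _ _ (1 * (e + 1))).
      by rewrite mul1r lerDl.
    by apply: ler_wpM2r; [exact: ltW|rewrite lerDr addr_ge0].
  apply: (@le_trans _ _ (d * (M + L + 1))).
    have -> : d * d + d * L + M * d = d * (M + L + d) by ring.
    by apply: ler_wpM2l; [exact: ltW|rewrite lerD2l].
  have -> : d * (M + L + 1) = e / (e + 1).
    by rewrite /d; field; rewrite !gt_eqF.
  by rewrite ler_pdivrMr //; apply: ler_peMr; [exact: ltW|rewrite lerDr ltW].
apply: (le_trans (ler_normD _ _)); apply: le_trans dE; rewrite lerD //.
  apply: (le_trans (ler_normD _ _)); rewrite lerD // normrM ler_pM ?h1 ?h2 ?gL //.
by rewrite normrM ler_pM ?fM ?h2.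
Qed.

Lemma boundedM f g : bounded f -> bounded g -> bounded (fun x => f x * g x).
Proof.
move=> [M M0 fM] [L L0 gL]; exists (M * L) => [|x Dx]; first exact: mulr_ge0.
by rewrite normrM ler_pM ?fM ?gL.
Qed.

Lemma ucv_prod J (s : seq J) (F : J -> nat -> X -> C) (f : J -> X -> C) :
  (forall j, ucv (F j) (f j)) -> (forall j, bounded (f j)) ->
  ucv (fun r x => \prod_(j <- s) F j r x) (fun x => \prod_(j <- s) f j x) /\
  bounded (fun x => \prod_(j <- s) f j x).
Proof.
move=> cF bf; elim: s => [|j s [IH1 IH2]].
  split=> [e e0|]; first by exists 0%N => r x _ _; rewrite !big_nil subrr normr0 ltW.
  by exists 1 => // x _; rewrite big_nil normr1.
split=> [e e0|].
  have [K hK] := ucvM (cF j) IH1 (bf j) IH2 e0.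
  by exists K => r x Kr Dx; rewrite !big_cons hK.
by have [M M0 hM] := boundedM (bf j) IH2; exists M => // x Dx; rewrite big_cons hM.
Qed.

Lemma ucv_sum J (s : seq J) (F : J -> nat -> X -> C) (f : J -> X -> C) :
  (forall j, ucv (F j) (f j)) ->
  ucv (fun r x => \sum_(j <- s) F j r x) (fun x => \sum_(j <- s) f j x).
Proof.
move=> cF; elim: s => [|j s IH].
  by move=> e e0; exists 0%N => r x _ _; rewrite !big_nil subrr normr0 ltW.
by move=> e e0; have [K hK] := ucvD (cF j) IH e0; exists K => r x Kr Dx; rewrite !big_cons hK.
Qed.
End UniformConvergence.

Section Limits.
Variable C : numClosedFieldType.
Local Notation cv s l := (@ucv C unit (fun=> True) (fun r _ => s r) (fun=> l)).

Lemma cv_unique (s : nat -> C) l1 l2 : cv s l1 -> cv s l2 -> l1 = l2.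
Proof.
move=> c1 c2; apply/eqP; rewrite -subr_eq0 -normr_le0.
rewrite real_leNgt ?real0 ?normr_real //; apply/negP => pos.
set d := `|_| in pos; have p4 : 0 < d / 4 by rewrite divr_gt0.
have [K1 h1] := c1 _ p4; have [K2 h2] := c2 _ p4.
have a1 := h1 (maxn K1 K2) tt (leq_maxl _ _) I; have a2 := h2 (maxn K1 K2) tt (leq_maxr _ _) I.
have : d <= d / 4 + d / 4.
  rewrite {1}/d; apply: le_trans (lerD a2 a1).
  have -> : l1 - l2 = (s (maxn K1 K2) - l2) - (s (maxn K1 K2) - l1) by ring.
  exact: ler_normB.
have -> : d / 4 + d / 4 = d / 2 by field.
rewrite ler_pdivlMr // mulr2n mulrDr mulr1 -subr_ge0 opprD addrA subrr add0r oppr_ge0.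
by move=> /(lt_le_trans pos); rewrite ltxx.
Qed.

Lemma cv_det k (F : nat -> 'M[C]_k) (A : 'M[C]_k) : (forall i j, cv (fun r => F r i j) (A i j)) ->
  cv (fun r => \det (F r)) (\det A).
Proof.
move=> cF; apply: ucv_sum => s; apply: ucvM; [exact: ucv_cst| |exact: bounded_cst|].
  have [h _] := @ucv_prod C unit (fun=> True) _ (index_enum 'I_k)
    (fun i r _ => F r i (s i)) (fun i _ => A i (s i)) (fun i => cF i (s i)) (fun i => bounded_cst _ _).
  exact: h.
exact: bounded_cst.
Qed.
End Limits.

Section Approximants.
Variable C : closedFieldType.

(** The list [bs] consists of the (r+1)-th roots of unity with one copy of 1 removed. *)
Lemma sub_exp_factor r : exists2 bs : seq C, size bs = r /\ 0 \notin bs &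
  forall w t, (w - t) * \prod_(b <- bs) (w - b * t) = w ^+ r.+1 - t ^+ r.+1.
Proof.
have [bs bsE] := closed_field_poly_normal ('X^(r.+1) - 1%:P : {poly C}).
rewrite lead_coefXnsubC // scale1r in bsE.
have sz : size bs = r.+1.
  by have := size_XnsubC (1 : C) (ltn0Sn r); rewrite bsE size_prod_XsubC => -[].
have E w t : \prod_(b <- bs) (w - b * t) = w ^+ r.+1 - t ^+ r.+1.
  have [->|t0] := eqVneq t 0.
    rewrite expr0n subr0 (eq_bigr (fun=> w)) => [|b _]; last by rewrite mulr0 subr0.
    by rewrite big_const_seq count_predT sz iter_mulr_1.
  have -> : w ^+ r.+1 - t ^+ r.+1 = t ^+ r.+1 * ('X^(r.+1) - 1%:P).[w / t].
    by rewrite !hornerE ?hornerXn expr_div_n mulrBr mulr1 mulrC divfK // expf_neq0.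
  rewrite bsE horner_prod -sz; elim: (bs) => [|b s IH]; first by rewrite !big_nil mulr1.
  rewrite !big_cons IH /= exprS hornerXsubC; by field.
have bs1 : 1 \in bs.
  have : root (\prod_(z <- bs) ('X - z%:P)) 1 by rewrite -bsE rootE !hornerE expr1n subrr.
  by rewrite root_prod_XsubC.
exists (rem 1 bs).
  split; first by rewrite size_rem // sz.
  apply: contraTN (oner_neq0 C) => /mem_rem b0; rewrite negbK.
  have := E 0 1; rewrite (big_rem 0 b0) /= mul0r subr0 mul0r expr0n expr1n /= sub0r.
  by move/eqP; rewrite eq_sym oppr_eq0.
by move=> w t; rewrite -E (big_rem 1 bs1) /= mul1r.
Qed.

Lemma num_approximant (xs : seq C) r : exists2 bs : seq C, size bs = (r * size xs)%N &
  forall z, \prod_(b <- bs) (1 - b * z) * \prod_(x <- xs) (1 - x * z) =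
    \prod_(x <- xs) (1 - (x * z) ^+ r.+1).
Proof.
have [cs [sc _] csE] := sub_exp_factor r.
elim: xs => [|x xs [bs sb bsE]].
  by exists [::] => [|z]; rewrite ?muln0 // !big_nil mulr1.
exists ([seq c * x | c <- cs] ++ bs) => [|z].
  by rewrite size_cat size_map sc sb mulnS.
have e : (1 - x * z) * \prod_(c <- cs) (1 - c * x * z) = 1 - (x * z) ^+ r.+1.
  by rewrite -[1 in RHS](expr1n _ r.+1) -csE; congr (_ * _); apply: eq_bigr => c _; rewrite mulrA.
by rewrite big_cat big_map !big_cons -bsE -e /=; ring.
Qed.

(** A factor 1 - c y / z equals - (c y) z^-1 (1 - z / (c y)), which brings the approximant into the
    form of a Laurent polynomial with roots in z; this is where nonzero [ys] are needed. *)
Lemma den_approximant (ys : seq C) r : 0 \notin ys ->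
  exists2 bk : seq C * C, size bk.1 = (r * size ys)%N &
  forall z, z != 0 -> bk.2 * z^-1 ^+ (r * size ys) * \prod_(b <- bk.1) (1 - b * z) *
    \prod_(y <- ys) (1 - y * z^-1) = \prod_(y <- ys) (1 - (y * z^-1) ^+ r.+1).
Proof.
have [cs [sc c0] csE] := sub_exp_factor r.
elim: ys => [|y ys IH].
  by move=> _; exists ([::], 1) => [|z _]; rewrite ?muln0 //= !big_nil !mul1r.
rewrite inE negb_or eq_sym => /andP[y0 /IH[[bs k] /= sb bsE]].
exists ([seq (c * y)^-1 | c <- cs] ++ bs, (\prod_(c <- cs) (- (c * y))) * k) => [|z z0] /=.
  by rewrite size_cat size_map sc sb mulnS.
rewrite big_cat big_map !big_cons -bsE //= mulnS exprD.
have e : \prod_(c <- cs) (- (c * y)) * z^-1 ^+ r * \prod_(c <- cs) (1 - (c * y)^-1 * z) * (1 - y * z^-1)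
   = 1 - (y * z^-1) ^+ r.+1.
  rewrite -[1 in RHS](expr1n _ r.+1) -csE mulrC; congr (_ * _).
  rewrite -sc; elim: (cs) c0 => [|c s IHs]; first by rewrite !big_nil !mulr1.
  rewrite inE negb_or eq_sym => /andP[c0 /IHs h]; rewrite !big_cons -h /= exprS.
  move: (\prod_(_ <- s) _) (\prod_(_ <- s) _) (z^-1 ^+ _) => p1 p2 p3.
  by field; rewrite z0 y0.
rewrite -e; ring.
Qed.
End Approximants.

Section MeanLimit.
Variables (C : numClosedFieldType) (n : nat) (m : unitary_mean C n.+1).
Hypothesis geom_small : forall x : C, `|x| < 1 -> forall e, 0 < e -> exists k, `|x| ^+ k < e.
Local Notation T := 'M[C]_n.+1.
Local Notation adm := (@adm C n.+1 m).
Local Notation mean := (@mean C n.+1 m).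
Local Notation small := (fun x : C => `|x| < 1).
Local Notation circle := (fun z : C => `|z| = 1).
Local Notation unitary := (fun u : T => u \is unitarymx).
Local Notation cv s l := (@ucv C unit (fun=> True) (fun r _ => s r) (fun=> l)).

Lemma ucv_comp X Y (D : X -> Prop) (D' : Y -> Prop) (w : Y -> X) F (f : X -> C) :
  (forall y, D' y -> D (w y)) -> ucv D F f -> ucv D' (fun r y => F r (w y)) (fun y => f (w y)).
Proof. by move=> h cF e /cF[K hK]; exists K => r y Kr /h; exact: hK. Qed.

Lemma bounded_comp X Y (D : X -> Prop) (D' : Y -> Prop) (w : Y -> X) (f : X -> C) :
  (forall y, D' y -> D (w y)) -> bounded D f -> bounded D' (fun y => f (w y)).
Proof. by move=> h [M M0 hM]; exists M => // y /h; exact: hM. Qed.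

Lemma cv_mean (F : nat -> T -> C) f : (forall r, adm (F r)) -> adm f ->
  ucv unitary F f -> cv (fun r => mean (F r)) (mean f).
Proof.
move=> aF af cF e e0; have e2 : 0 < e / 2 by rewrite divr_gt0.
have [K hK] := cF _ e2; exists K => r _ Kr _; rewrite -meanB //.
have -> : e = 2 * (e / 2) by field.
by apply: mean_bound => [|u uU]; [exact: admB|exact: hK].
Qed.

Lemma ucv_pow x : small x -> ucv circle (fun r z => 1 - (x * z) ^+ r.+1) (fun=> 1).
Proof.
move=> x1 e e0; have [K hK] := geom_small x1 e0.
exists K => r z Kr z1; rewrite addrAC subrr sub0r normrN normrX normrM z1 mulr1.
apply: le_trans (ltW hK); apply: ler_wiXn2l; rewrite ?normr_ge0 ?ltW //.
exact: leqW.
Qed.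

Lemma bounded_lin b : bounded circle (fun z => 1 - b * z).
Proof.
exists (1 + `|b|) => [|z z1]; first by rewrite addr_ge0.
by apply: (le_trans (ler_normB _ _)); rewrite normr1 normrM z1 mulr1.
Qed.

Lemma bounded_geom x : small x -> bounded circle (fun z => (1 - x * z)^-1).
Proof.
move=> x1; have d0 : 0 < 1 - `|x| by rewrite subr_gt0.
exists (1 - `|x|)^-1 => [|z z1]; first by rewrite invr_ge0 ltW.
have h : 1 - `|x| <= `|1 - x * z|.
  by apply: le_trans (lerB_dist _ _); rewrite normr1 normrM z1 mulr1.
by rewrite normfV lef_pV2 // posrE (lt_le_trans d0).
Qed.

Lemma bounded_prod J (s : seq J) (P : pred J) (D : C -> Prop) (f : J -> C -> C) :
  (forall j, P j -> bounded D (f j)) -> all P s -> bounded D (fun x => \prod_(j <- s) f j x).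
Proof.
move=> bf; elim: s => [|j s IH] /=.
  by move=> _; exists 1 => // x _; rewrite big_nil normr1.
move=> /andP[Pj /IH bs]; have [M M0 hM] := boundedM (bf _ Pj) bs.
by exists M => // x Dx; rewrite big_cons hM.
Qed.

Lemma circle_inv z : circle z -> circle z^-1.
Proof. by move=> /= z1; rewrite normfV z1 invr1. Qed.

Lemma norm_circle_exprz (z : C) (k : int) : `|z| = 1 -> `|z ^ k| = 1.
Proof.
by move=> z1; case: k => k; rewrite ?NegzE -?exprnP -?exprnN ?normfV normrX z1 expr1n ?invr1.
Qed.

Variables (I : finType) (a : I -> C) (xs ys : seq C).
Hypothesis xs_small : all small xs.
Hypothesis ys_small : all small ys.
Hypothesis ys0 : 0 \notin ys.
Hypothesis card_I : #|I| = (size ys + size xs)%N.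

Let q := size ys.
Let phi := symbol q ys a setT xs.
(** Multiplication by [err r] cancels every denominator of [phi], since 1 - t divides 1 - t^(r+1),
    and [err r] tends uniformly to 1 on the circle. *)
Let err r z := (\prod_(x <- xs) (1 - (x * z) ^+ r.+1)) * \prod_(y <- ys) (1 - (y * z^-1) ^+ r.+1).

Let bounded_phi : bounded circle phi.
Proof.
apply: boundedM; last first.
  apply: (@bounded_prod _ ys small) => // y y1.
  exact: (bounded_comp circle_inv (bounded_geom y1)).
apply: boundedM; last by apply: (@bounded_prod _ xs small) => // x; exact: bounded_geom.
apply: boundedM.
  by exists 1 => // z z1; rewrite norm_circle_exprz.
have [M M0 hM] := @bounded_prod _ (enum I) predT circle (fun k z => 1 - a k * z)
  (fun k _ => bounded_lin (a k)) (all_predT _).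
exists M => // z z1; rewrite (_ : \prod_(k in [set: I]) _ = \prod_(k <- enum I) (1 - a k * z)) ?hM //.
by rewrite big_enum; apply: eq_bigl => k; rewrite inE.
Qed.

Let ucv_err : ucv circle err (fun=> 1).
Proof.
have one (ws : seq C) (w : C -> C) : (forall z, circle z -> circle (w z)) -> all small ws ->
    ucv circle (fun r z => \prod_(x <- ws) (1 - (x * w z) ^+ r.+1)) (fun=> 1).
  move=> hw; elim: ws => [|x s IH] /=.
    by move=> _ e e0; exists 0%N => r z _ _; rewrite big_nil subrr normr0 ltW.
  move=> /andP[x1 /IH cs] e e0.
  have [K hK] := ucvM (ucv_comp hw (ucv_pow x1)) cs (bounded_cst _ 1) (bounded_cst _ 1) e0.
  by exists K => r z Kr z1; rewrite big_cons; have := hK r z Kr z1; rewrite mulr1.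
have h := ucvM (one xs id (fun z h => h) xs_small) (one ys _ circle_inv ys_small)
  (bounded_cst _ 1) (bounded_cst _ 1).
by move=> e /h[K hK]; exists K => r z Kr z1; have := hK r z Kr z1; rewrite mulr1.
Qed.

Variable spec : T -> seq C.
Hypothesis spec_size : forall u, unitary u -> size (spec u) = n.+1.
Hypothesis spec_norm : forall u z, unitary u -> z \in spec u -> `|z| = 1.
Hypothesis spec_det1B : forall u c, unitary u -> \det (1%:M - c *: u) = \prod_(z <- spec u) (1 - c * z).
Hypothesis spec_det : forall u, unitary u -> \det u = \prod_(z <- spec u) z.

Let approx_symbol r : exists2 Lk : seq C * C, (q + r * q <= size Lk.1)%N &
  forall z, circle z ->
    Lk.2 * z^-1 ^+ (q + r * q) * \prod_(b <- Lk.1) (1 - b * z) = phi z * err r z.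
Proof.
have [bs sbs bsE] := num_approximant xs r.
have [[cs k] /= scs csE] := den_approximant r ys0.
exists ([seq a k | k <- enum I] ++ bs ++ cs, k) => /= [|z z1].
  by rewrite !size_cat size_map -cardE card_I sbs scs -/q; lia.
have z0 : z != 0 by rewrite -normr_eq0 z1 oner_eq0.
have nz (ws : seq C) t : circle t -> all small ws -> \prod_(x <- ws) (1 - x * t) != 0.
  move=> t1 aws; rewrite prodf_seq_neq0; apply/allP => x /(allP aws) x1 /=.
  rewrite subr_eq0; apply: contraTneq x1 => e.
  have -> : `|x| = 1 by rewrite -(normr1 C) e normrM t1 mulr1.
  by rewrite ltxx.
have nx := nz xs z z1 xs_small; have ny := nz ys _ (circle_inv z1) ys_small.
have -> : \prod_(b <- [seq a k | k <- enum I] ++ bs ++ cs) (1 - b * z) =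
    \prod_(k in [set: I]) (1 - a k * z) * (\prod_(b <- bs) (1 - b * z) * \prod_(b <- cs) (1 - b * z)).
  rewrite !big_cat big_map big_enum /=; congr (_ * _).
  by apply: eq_bigl => i; rewrite in_setT.
rewrite /phi /symbol /err. rewrite -(bsE z) -(csE z) // !prodfV.
rewrite exprD -exprnN exprVn -/q -exprVn.
move: nx ny; set p1 := \prod_(x <- xs) _; set p2 := \prod_(y <- ys) _.
move: (\prod_(_ in _) _) (\prod_(_ <- bs) _) (\prod_(_ <- cs) _) (z^-1 ^+ q) (z^-1 ^+ _) => p3 p4 p5 p6 p7 h1 h2.
by field; rewrite h1 h2.
Qed.

Let adm_err r : adm (fun u => err r (\det u)).
Proof.
apply: admM; apply: adm_prod => x; apply: admB; try exact: adm_cst.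
  by apply: admX; apply: admZ; exact: adm_det_id.
by apply: admX; apply: admZ; exact: adm_det_inv.
Qed.

(** [heine_szego] for the Laurent polynomial phi * err r. Its leading constant k occurs once per
    eigenvalue in the product and once per row in the determinant, so both sides scale by
    k^(n+1). *)
Let approx_mean r : exists2 G : T -> C, adm G /\ (forall u, unitary u -> G u = \prod_(z <- spec u) (phi z * err r z)) &
  mean G = \det (toeplitz n.+1 (fun k : int => mean (fun u => phi (\det u) * err r (\det u) * \det u ^ (- k)))).
Proof.
have [[L k] /= sL LE] := approx_symbol r; set qr := (q + r * q)%N in sL LE.
have LI : (qr <= #|'I_(size L)|)%N by rewrite card_ord.
have HS := heine_szego m geom_small LI (fun i : 'I_(size L) => tnth (in_tuple L) i).
pose H (u : T) := detV qr u * \prod_i \det (1%:M - tnth (in_tuple L) i *: u).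
have aH : adm H.
  apply: admM; first exact: adm_detV.
  by apply: adm_prod => i; apply: adm_poly; exact: polyfun_det1B.
exists (fun u => k ^+ n.+1 * H u).
  split=> [|u uU]; first exact: admZ.
  transitivity (\prod_(z <- spec u) (k * z^-1 ^+ qr * \prod_(b <- L) (1 - b * z))); last first.
    by apply: eq_big_seq => z zs; rewrite LE //; exact: spec_norm zs.
  rewrite big_split /= big_split /= -mulrA; congr (_ * (_ * _)).
  - by rewrite big_const_seq count_predT spec_size // iter_mulr_1.
  - by rewrite /detV spec_det // prodrXl -prodfV.
  rewrite exchange_big /= (big_tnth _ _ L); apply: eq_bigr => i _.
  by rewrite spec_det1B.
rewrite meanZ // HS -detZ; congr determinant; apply/matrixP => i j; rewrite !mxE -meanZ; last first.
  apply: admM; first exact: adm_det_exprz.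
  by apply: adm_prod => l; apply: admB; [exact: adm_cst|apply: admZ; exact: adm_det_id].
apply: mean_ext => u uU; have d0 := det_unitary_neq0 uU.
rewrite -LE; last exact: norm_det_unitary.
by rewrite expfzDr // -exprnN -exprVn (big_tnth _ _ L); ring.
Qed.

(** Let r tend to infinity in [approx_mean]: the integrands converge uniformly on unitary matrices
    because the number of eigenvalues is fixed, and the determinants converge entrywise. *)
Lemma mean_det_symbol f : adm f -> (forall u, unitary u -> f u = \prod_(z <- spec u) phi z) ->
  mean f = \det (symbol_toeplitz m q ys a setT xs).
Proof.
move=> af fE; have [G GE] := choice (fun r => let: ex_intro2 G h1 h2 := approx_mean r in ex_intro _ G (conj h1 h2)).
have cG : ucv unitary G f.
  pose zi (i : 'I_n.+1) u := nth 1 (spec u) i.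
  have zi1 i u : unitary u -> circle (zi i u).
    by move=> uU; apply: (spec_norm uU); rewrite mem_nth // spec_size.
  have prodE u (F : C -> C) : unitary u -> \prod_(z <- spec u) F z = \prod_(i < n.+1) F (zi i u).
    by move=> uU; rewrite (big_nth 1) spec_size // big_mkord.
  have bF (i : 'I_n.+1) : bounded unitary (fun u => phi (zi i u)).
    by apply: (bounded_comp _ bounded_phi) => u; exact: zi1.
  have cF (i : 'I_n.+1) : ucv unitary (fun r u => phi (zi i u) * err r (zi i u)) (fun u => phi (zi i u) * 1).
    apply: ucvM; [exact: ucv_cst| |exact: bF|exact: bounded_cst].
    by apply: (ucv_comp (D := circle) _ ucv_err) => u; exact: zi1.
  have [h _] := ucv_prod (index_enum 'I_n.+1) cF (fun i => boundedM (bF i) (bounded_cst _ 1)).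
  move=> e /h[K hK]; exists K => r u Kr uU.
  rewrite (GE r).1.2 // fE // !prodE //; have := hK r u Kr uU.
  by under [X in _ - X]eq_bigr do rewrite mulr1.
have c1 := cv_mean (fun r => (GE r).1.1) af cG.
pose M r : 'M[C]_n.+1 := toeplitz n.+1 (fun k : int => mean (fun u => phi (\det u) * err r (\det u) * \det u ^ (- k))).
have c2 : cv (fun r => \det (M r)) (mean f).
  by move=> e /c1[K hK]; exists K => r x Kr x0; rewrite -(GE r).2; exact: hK.
apply: (cv_unique c2); apply: cv_det => i j; set k := (i%:Z - j%:Z).
have U u : unitary u -> circle (\det u) by exact: norm_det_unitary.
have a1 r : adm (fun u => phi (\det u) * err r (\det u) * \det u ^ (- k)).
  by apply: admM; [apply: admM; [exact: adm_symbol|exact: adm_err]|exact: adm_det_exprz].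
have a2 : adm (fun u => phi (\det u) * \det u ^ (- k)) by exact: adm_symbol_pow.
have b1 : bounded circle (fun z : C => z ^ (- k)) by exists 1 => // z z1; rewrite norm_circle_exprz.
have c3 := ucvM (ucvM (ucv_cst circle phi) ucv_err bounded_phi (bounded_cst _ 1))
  (ucv_cst circle (fun z => z ^ (- k))) (boundedM bounded_phi (bounded_cst _ 1)) b1.
have c4 : ucv unitary (fun r u => phi (\det u) * err r (\det u) * \det u ^ (- k)) (fun u => phi (\det u) * \det u ^ (- k)).
  move=> e /(ucv_comp U c3)[K hK]; exists K => r u Kr uU.
  by have := hK r u Kr uU; rewrite mulr1.
have c5 := cv_mean a1 a2 c4.
by move=> e /c5[K hK]; exists K => r x Kr x0; rewrite !mxE; exact: hK.
Qed.
End MeanLimit.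

(** * The ratio formula *)

Section MeanRatio.
Variables (C : numClosedFieldType) (n : nat) (m : unitary_mean C n.+1).
Hypothesis geom_small : forall x : C, `|x| < 1 -> forall e, 0 < e -> exists k, `|x| ^+ k < e.
Local Notation T := 'M[C]_n.+1.
Local Notation adm := (@adm C n.+1 m).
Local Notation mean := (@mean C n.+1 m).
Local Notation small := (fun x : C => `|x| < 1).
Variables (I : finType) (a c : I -> C) (B : {set I}).
Hypothesis a_inj : injective a.
Hypothesis a_neq0 : forall k, a k != 0.
Hypothesis c_small : forall j, j \notin B -> `|c j| < 1.
Hypothesis c_large : forall l, l \in B -> 1 < `|c l|.

Definition ratio_term (S : {set I}) : C :=
  (\prod_(s in S) a s ^+ n.+1) / (\prod_(l in B) c l ^+ n.+1) *
  ((\prod_(s in S) \prod_(j in ~: B) (1 - c j / a s)) *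
   (\prod_(t in ~: S) \prod_(l in B) (1 - a t / c l))) /
  ((\prod_(s in S) \prod_(t in ~: S) (1 - a t / a s)) *
   (\prod_(l in B) \prod_(j in ~: B) (1 - c j / c l))).

Let xs := [seq c j | j <- enum (~: B)].
Let ys := [seq (c l)^-1 | l <- enum B].

Let xs_small : all small xs.
Proof. by apply/allP => _ /mapP[j + ->]; rewrite mem_enum inE; exact: c_small. Qed.

Let c_neq0 l : l \in B -> c l != 0.
Proof. by move=> /c_large h; rewrite -normr_gt0 (lt_trans ltr01). Qed.

Let ys_small : all small ys.
Proof.
apply/allP => _ /mapP[l + ->]; rewrite mem_enum => lB.
by rewrite normfV invf_lt1 ?c_large // normr_gt0 c_neq0.
Qed.

Let ys0 : 0 \notin ys.
Proof.
apply/negP => /mapP[l]; rewrite mem_enum => /c_neq0 l0 /eqP.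
by rewrite eq_sym invr_eq0 (negPf l0).
Qed.

Let big_xs (F : C -> C) : \prod_(x <- xs) F x = \prod_(j in ~: B) F (c j).
Proof. by rewrite big_map big_enum. Qed.

Let big_ys (F : C -> C) : \prod_(y <- ys) F y = \prod_(l in B) F (c l)^-1.
Proof. by rewrite big_map big_enum. Qed.

Let c_norm k : `|c k| != 1.
Proof.
have [kB|kB] := boolP (k \in B); first by rewrite gt_eqF ?c_large.
by rewrite lt_eqF ?c_small.
Qed.

(** The inverse is admissible because each eigenvalue factor satisfies |1 - c z| >= |1 - |c||, which
    is positive as |c| differs from 1. *)
Lemma adm_ratio : adm (fun u => \prod_k (\det (1%:M - a k *: u) / \det (1%:M - c k *: u))).
Proof.
apply: adm_prod => k; apply: admM; first by apply: adm_poly; exact: polyfun_det1B.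
apply: (admV (e := `|1 - `|c k| | ^+ n.+1)).
- by apply: adm_poly; exact: polyfun_det1B.
- by rewrite exprn_gt0 // normr_gt0 subr_eq0 eq_sym.
move=> u /unitarymx_spectrum[s [ss s1] [-> _ _]]; rewrite -ss normr_prod.
elim: s s1 {ss} => [|z s IH] s1; first by rewrite big_nil expr0.
rewrite big_cons exprS; apply: ler_pM; rewrite ?exprn_ge0 //.
  by rewrite -[X in `|X - _|]normr1 -[`|c k|]mulr1 -(s1 z (mem_head _ _)) -normrM; exact: ler_dist_dist.
by apply: IH => y ys'; apply: s1; rewrite inE ys' orbT.
Qed.

Theorem mean_ratio :
  mean (fun u => \prod_k (\det (1%:M - a k *: u) / \det (1%:M - c k *: u))) =
  \sum_(S : {set I} | #|S| == #|B|) ratio_term S.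
Proof.
pose P (u : T) (s : seq C) := u \is unitarymx ->
  [/\ size s = n.+1, forall z, z \in s -> `|z| = 1,
      forall b, \det (1%:M - b *: u) = \prod_(z <- s) (1 - b * z) & \det u = \prod_(z <- s) z].
have spec_ex u : exists s, P u s.
  have [uU|nU] := boolP (u \is unitarymx).
    by have [s [ss s1] [d1 d2 _]] := unitarymx_spectrum uU; exists s.
  by exists [::] => uU; rewrite uU in nU.
have [spec specP] := choice spec_ex.
(* For [l] in [B], 1/(1 - c z) is - c^-1 z^-1 times a geometric factor in z^-1. The constants - c^-1
   occur once for each of the [n.+1] eigenvalues and form [kap]; the powers z^-1 form the z^-q of
   the symbol. *)
pose kap := (\prod_(l in B) (- (c l)^-1)) ^+ n.+1.
have kap0 : kap != 0.
  by rewrite expf_neq0 //; apply/prodf_neq0 => l lB; rewrite oppr_eq0 invr_eq0 c_neq0.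
set f := (fun u => _).
have cI : #|[set: I]| = (size ys + size xs)%N by rewrite cardsT !size_map -!cardE cardsC.
have sizeB : size ys = #|B| by rewrite size_map -cardE.
have fE : mean f = kap * \det (symbol_toeplitz m (size ys) ys a [set: I] xs).
  have af : adm (fun u => kap^-1 * f u) by apply: admZ; exact: adm_ratio.
  rewrite -(@mean_det_symbol C n m geom_small I a xs ys xs_small ys_small ys0 _ spec _ _ _ _ (fun u => kap^-1 * f u)) //.
  - by rewrite meanZ ?mulVKf //; exact: adm_ratio.
  - by rewrite -cI cardsT.
  - by move=> u /specP[].
  - by move=> u z /specP[_ h _ _]; exact: h.
  - by move=> u b /specP[_ _ h _].
  - by move=> u /specP[].
  move=> u /[dup] uU /specP[ss s1 d1 _]; rewrite /f; apply: (mulfI kap0); rewrite mulVKf //.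
  have -> : \prod_k (\det (1%:M - a k *: u) / \det (1%:M - c k *: u)) =
     \prod_(z <- spec u) \prod_k ((1 - a k * z) / (1 - c k * z)).
    rewrite exchange_big /=; apply: eq_bigr => k _.
    by rewrite big_split /= !d1 prodfV.
  rewrite /kap -ss -iter_mulr_1 -(count_predT (spec u)) -big_const_seq -big_split /=.
  apply: eq_big_seq => z zs; have z1 := s1 z zs.
  have z0 : z != 0 by rewrite -normr_eq0 z1 oner_eq0.
  rewrite big_split /= /symbol big_xs big_ys -exprnN -exprVn.
  rewrite (eq_bigl (fun k => k \in [set: I])) => [|k]; last by rewrite inE.
  rewrite [X in _ * X](bigID (mem B)) /=.
  have -> : z^-1 ^+ size ys = \prod_(l in B) z^-1 by rewrite prodr_const sizeB.
  have -> : \prod_(k in B) (1 - c k * z)^-1 = \prod_(l in B) (- (c l)^-1) * \prod_(l in B) z^-1 *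
      \prod_(l in B) (1 - (c l)^-1 * z^-1)^-1.
    rewrite -!big_split /=; apply: eq_bigr => l lB; have l0 := c_neq0 lB.
    rewrite -!invfM -[- _^-1]invrN -!invfM; congr (_^-1); by field; rewrite z0 l0.
  rewrite [X in _ = _ * (_ * _ * X * _)](eq_bigl (fun j => j \notin B)) => [|j]; last by rewrite inE.
  by ring.
have den (x : C) : (den_poly ys).[x] = \prod_(l in B) (1 - x / c l).
  by rewrite den_polyE big_ys; apply: eq_bigr => l _; rewrite mulrC.
have := toeplitz_ratio_sum m geom_small ys_small (leqnn _) a_inj a_neq0 cI xs_small.
set DT := \det _ in fE *; rewrite big_xs => e.
have W0 : \prod_(j in ~: B) (den_poly ys).[c j] != 0.
  apply/prodf_neq0 => j; rewrite inE => jB; rewrite den; apply/prodf_neq0 => l lB.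
  rewrite subr_eq0; apply: contraTneq (c_small jB) => h.
  have -> : c j = c l by rewrite -[LHS](divfK (c_neq0 lB)) -h mul1r.
  by rewrite lt_gtF // c_large.
have {}e : DT = ratio_sum a (size ys) n.+1 (fun x => (den_poly ys).[x]) [set: I] xs /
    \prod_(j in ~: B) (den_poly ys).[c j] by rewrite -e mulrC mulKf.
rewrite fE e /ratio_sum mulr_suml mulr_sumr; apply: eq_big => [S|S /andP[_ /eqP cS]].
  by rewrite subsetT sizeB.
rewrite /ratio_term setTD big_split /=.
have -> : \prod_(s in S) \prod_(x <- xs) (1 - x / a s) = \prod_(s in S) \prod_(j in ~: B) (1 - c j / a s).
  by apply: eq_bigr => s _; rewrite big_xs.
have -> : \prod_(t in ~: S) (den_poly ys).[a t] = \prod_(t in ~: S) \prod_(l in B) (1 - a t / c l).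
  by apply: eq_bigr => t _; rewrite den.
have -> : \prod_(j in ~: B) (den_poly ys).[c j] = \prod_(l in B) \prod_(j in ~: B) (1 - c j / c l).
  by rewrite exchange_big /=; apply: eq_bigr => j _; rewrite den.
have -> : kap = (-1) ^+ (#|B| * n.+1) / \prod_(l in B) c l ^+ n.+1.
  by rewrite /kap prodrN exprMn -exprM prodfV exprVn prodrXl.
have -> : \prod_(s in S) (- a s) ^+ n.+1 = (-1) ^+ (#|B| * n.+1) * \prod_(s in S) a s ^+ n.+1.
  by rewrite !prodrXl prodrN exprMn -exprM cS sizeB.
(* The sign of [kap] meets the sign of the factors (- a s)^(n+1); both exponents are #|B| (n+1)
   because [S] and [B] have the same size. *)
have sg : (-1 : C) ^+ (#|B| * n.+1) * (-1) ^+ (#|B| * n.+1) = 1 by rewrite -exprMn mulrNN mulr1 expr1n.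
rewrite invfM; move: ((-1) ^+ _) sg => sgn sg.
move: (\prod_(s in S) a s ^+ _) (\prod_(l in B) c l ^+ _)^-1 => p1 p2.
move: (\prod_(s in S) \prod_(j in ~: B) _) (\prod_(t in ~: S) _) => p3 p4.
move: (\prod_(s in S) _)^-1 (\prod_(l in B) _)^-1 => p5 p6.
transitivity (sgn * sgn * (p1 * p2 * (p3 * p4) * (p5 * p6))); first by ring.
by rewrite sg mul1r.
Qed.
End MeanRatio.

(** * From sums over subsets to sums over permutations *)

Section PermImages.
Variables (T : finType).

Lemma perm_imset_exists (B S : {set T}) : #|B| = #|S| -> exists w : {perm T}, w @: B = S.
Proof.
move=> cBS; pose e (A : {set T}) := enum A ++ enum (~: A).
have ue A : uniq (e A).
  rewrite cat_uniq !enum_uniq andbT /=; apply/hasPn => x.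
  by rewrite !mem_enum inE.
have me A x : x \in e A by rewrite mem_cat !mem_enum inE orbN.
have se A : size (e A) = #|T|.
  by rewrite size_cat -!cardE cardsC.
pose f x := nth x (e S) (index x (e B)).
have f_inj : injective f.
  move=> x y; rewrite /f (set_nth_default x) ?se -?(se B) ?index_mem //.
  move=> /eqP; rewrite nth_uniq // ?se -?(se B) ?index_mem // => /eqP.
  by apply: index_inj.
exists (perm f_inj); apply/eqP; rewrite eqEcard card_imset ?cBS; last exact: perm_inj.
rewrite leqnn andbT; apply/subsetP => _ /imsetP[x xB ->]; rewrite permE /f.
have ix : (index x (e B) < #|S|)%N.
  by rewrite index_cat mem_enum xB -cBS cardE index_mem mem_enum.
by rewrite nth_cat -cardE ix -mem_enum mem_nth // -cardE.
Qed.

(** Translation by a permutation carrying [B] to [S] shows that all fibres of w |-> w @: B have the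
    same size; dividing |T|! by the number of subsets gives it. *)
Lemma card_perm_imset (B S : {set T}) : #|B| = #|S| ->
  #|[set w : {perm T} | w @: B == S]| = (#|B|`! * (#|T| - #|B|)`!)%N.
Proof.
pose st (S : {set T}) := [set w : {perm T} | w @: B == S].
have cst (S' : {set T}) : #|B| = #|S'| -> #|st S'| = #|st B|.
  move=> /perm_imset_exists[w0 w0E]; rewrite -(card_imset (st B) (mulIg w0)).
  apply: eq_card => w; apply/idP/imsetP => [|[v vB ->]].
    rewrite inE => /eqP wB; exists (w * w0^-1)%g; last by rewrite mulgKV.
    rewrite inE; apply/eqP; apply: (imset_inj (@perm_inj _ w0)).
    rewrite w0E -imset_comp -wB; apply: eq_imset => x /=; by rewrite permM permKV.
  move: vB; rewrite !inE => /eqP vB; apply/eqP; rewrite -w0E -[in RHS]vB -imset_comp.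
  by apply: eq_imset => x; rewrite /= permM.
move=> cS; rewrite -/(st S) (cst S cS).
have : (#|{perm T}| = \sum_(S' : {set T} | #|S'| == #|B|) #|st S'|)%N.
  rewrite -[LHS]sum1_card (partition_big (fun w : {perm T} => w @: B) (fun S' : {set T} => #|S'| == #|B|)) /=.
    by apply: eq_bigr => S' _; rewrite -sum1_card; apply: eq_bigl => w; rewrite inE.
  by move=> w _; rewrite card_imset //; exact: perm_inj.
rewrite (eq_bigr (fun=> #|st B|)) => [|S' /eqP e]; last by rewrite cst.
rewrite sum_nat_const.
have -> : #|{perm T}| = (#|T|)`!.
  by rewrite -[X in X`!]cardsT -card_perm; apply: eq_card => w; rewrite unfold_in; apply/esym/subsetP.
rewrite (_ : #|_| = 'C(#|T|, #|B|)); last first.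
  by rewrite -card_draws; apply: eq_card => S'; rewrite !inE.
rewrite -(bin_fact (max_card (mem B))) => /eqP.
by rewrite eqn_mul2l eqn0Ngt bin_gt0 max_card /= => /eqP.
Qed.

Lemma sum_perm_imset (V : nmodType) (B : {set T}) (G : {set T} -> V) :
  \sum_(w : {perm T}) G (w @: B) =
  (\sum_(S : {set T} | #|S| == #|B|) G S) *+ (#|B|`! * (#|T| - #|B|)`!).
Proof.
rewrite (partition_big (fun w : {perm T} => w @: B) (fun S : {set T} => #|S| == #|B|)) /=; last first.
  by move=> w _; rewrite card_imset //; exact: perm_inj.
rewrite -sumrMnl; apply: eq_bigr => S /eqP cS.
rewrite -(card_perm_imset (esym cS)) -sumr_const; apply: eq_big => [w|w /eqP -> //].
by rewrite inE.
Qed.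
End PermImages.

Lemma ratio_term_perm (K : numClosedFieldType) n (I : finType) (a c : I -> K) (B : {set I}) (w : {perm I}) :
  ratio_term n a c B (w @: B) =
  \prod_(l in B) (a (w l) ^+ n.+1 / c l ^+ n.+1 *
    \prod_(j in ~: B) (((1 - c j / a (w l)) * (1 - a (w j) / c l)) /
      ((1 - a (w j) / a (w l)) * (1 - c j / c l)))).
Proof.
have wC : ~: (w @: B) = w @: (~: B).
  by apply/setP => x; rewrite -(permKV w x) inE !mem_imset ?inE //; exact: perm_inj.
have wI (A : {set I}) (F : I -> K) : \prod_(s in w @: A) F s = \prod_(l in A) F (w l).
  by rewrite big_imset //= => x y _ _; exact: perm_inj.
rewrite /ratio_term wC !wI.
under [X in _ * (_ * _) / (X * _) = _]eq_bigr do rewrite wI.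
rewrite [X in _ * (_ * X) / _]exchange_big /=.
under [RHS]eq_bigr => l _.
  rewrite [X in _ * X](_ : _ = (\prod_(j in ~: B) (1 - c j / a (w l)) * \prod_(j in ~: B) (1 - a (w j) / c l)) /
    (\prod_(j in ~: B) (1 - a (w j) / a (w l)) * \prod_(j in ~: B) (1 - c j / c l))); last first.
    by rewrite -!big_split /= -prodfV -big_split.
  over.
by rewrite !big_split /= !prodfV !big_split /= -[LHS]mulrA.
Qed.

(** * Integration against the Haar measure *)

From mathcomp Require Import all_classical all_reals all_analysis.
From mathcomp Require Import complex measurable_realfun.
Import Order.TTheory GRing.Theory Num.Theory.
Local Open Scope classical_set_scope.
Local Open Scope ring_scope.
Local Open Scope complex_scope.

Section ComplexMeasurable.
Variables (R : realType) (N : nat).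
Local Notation C := R[i].
Local Notation T := (MxT R N).

Definition cmeas (f : T -> C) :=
  measurable_fun setT (fun u => complex.Re (f u)) /\
  measurable_fun setT (fun u => complex.Im (f u)).

Lemma cReD (x y : C) : complex.Re (x + y) = complex.Re x + complex.Re y.
Proof. by case: x; case: y. Qed.
Lemma cImD (x y : C) : complex.Im (x + y) = complex.Im x + complex.Im y.
Proof. by case: x; case: y. Qed.
Lemma cReM (x y : C) : complex.Re (x * y) = complex.Re x * complex.Re y - complex.Im x * complex.Im y.
Proof. by case: x; case: y. Qed.
Lemma cImM (x y : C) : complex.Im (x * y) = complex.Re x * complex.Im y + complex.Im x * complex.Re y.
Proof. by case: x; case: y. Qed.

Lemma cmeas_cst c : cmeas (fun=> c).
Proof. by split; exact: measurable_cst. Qed.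

Lemma cmeas_entry i j : cmeas (fun u : T => (u : 'M[C]_N) i j).
Proof.
split=> _ B mB; rewrite setTI; apply: sub_gen_smallest;
  exists i, j, B; split=> //; by [left | right].
Qed.

Lemma cmeasD f g : cmeas f -> cmeas g -> cmeas (fun u => f u + g u).
Proof.
move=> [f1 f2] [g1 g2]; split.
  by under eq_fun do rewrite cReD; exact: measurable_funD.
by under eq_fun do rewrite cImD; exact: measurable_funD.
Qed.

Lemma cmeasM f g : cmeas f -> cmeas g -> cmeas (fun u => f u * g u).
Proof.
move=> [f1 f2] [g1 g2]; split.
  by under eq_fun do rewrite cReM; apply: measurable_funB; exact: measurable_funM.
by under eq_fun do rewrite cImM; apply: measurable_funD; exact: measurable_funM.
Qed.

Lemma cmeas_conj f : cmeas f -> cmeas (fun u => (f u)^*).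
Proof.
move=> [f1 f2]; split.
  by under eq_fun => u do (have -> : complex.Re (f u)^* = complex.Re (f u) by case: (f u)).
under eq_fun => u do (have -> : complex.Im (f u)^* = - complex.Im (f u) by case: (f u)).
exact: measurableT_comp.
Qed.

(** Inversion is continuous off 0, and the single point 0 is treated apart. *)
Lemma measurable_inv : measurable_fun setT (fun x : R => x^-1).
Proof.
have -> : setT = [set r : R | r != 0] `|` [set (0 : R)].
  by apply/seteqP; split=> r //= _; have [->|] := eqVneq r 0; [right | left].
apply/measurable_funU => //; first exact: open_measurable.
split; last first.
  apply: (@eq_measurable_fun _ _ _ _ _ (fun=> 0 : R)); last exact: measurable_cst.
  by move=> x; rewrite inE /= => ->; rewrite invr0.
apply: open_continuous_measurable_fun => //; apply/in_setP => x /= x0.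
exact: inv_continuous.
Qed.

Lemma cmeasV f : cmeas f -> cmeas (fun u => (f u)^-1).
Proof.
move=> [f1 f2].
have md : measurable_fun setT (fun u => (complex.Re (f u) ^+ 2 + complex.Im (f u) ^+ 2)^-1).
  apply: (measurableT_comp measurable_inv).
  by apply: measurable_funD; exact: measurable_funX.
split.
  under eq_fun => u.
    have -> : complex.Re (f u)^-1 = complex.Re (f u) * (complex.Re (f u) ^+ 2 + complex.Im (f u) ^+ 2)^-1.
      by case: (f u).
    over.
  exact: measurable_funM.
under eq_fun => u.
  have -> : complex.Im (f u)^-1 = - (complex.Im (f u) * (complex.Re (f u) ^+ 2 + complex.Im (f u) ^+ 2)^-1).
    by case: (f u).
  over.
exact: (measurable_funN (measurable_funM f2 md)).
Qed.

Lemma cmeas_sum I (s : seq I) (P : pred I) (F : I -> T -> C) :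
  (forall i, cmeas (F i)) -> cmeas (fun u => \sum_(i <- s | P i) F i u).
Proof.
move=> mF; elim: s => [|i s IH].
  by under [X in cmeas X]eq_fun => u do rewrite big_nil; exact: cmeas_cst.
under [X in cmeas X]eq_fun => u do rewrite big_cons.
by case: (P i) => //; exact: cmeasD.
Qed.

(** The unitary matrices are the zero set of the sum of squares of the real and imaginary parts of
    the entries of u u^* - 1. *)
Lemma measurable_unitary : measurable ([set u | unitary_mx u] : set T).
Proof.
pose d (u : T) : 'M[C]_N := (u : 'M[C]_N) *m (map_mx conjc (u : 'M[C]_N))^T - 1%:M.
have md i j : cmeas (fun u => d u i j).
  rewrite /d; under [X in cmeas X]eq_fun => u do rewrite !mxE.
  apply: cmeasD; last exact: cmeas_cst.
  apply: cmeas_sum => k; apply: cmeasM; first exact: cmeas_entry.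
  under [X in cmeas X]eq_fun => u do rewrite !mxE.
  by apply: cmeas_conj; exact: cmeas_entry.
pose g u := \sum_i \sum_j (complex.Re (d u i j) ^+ 2 + complex.Im (d u i j) ^+ 2).
have -> : [set u | unitary_mx u] = setT `&` g @^-1` [set 0].
  rewrite setTI; apply/seteqP; split => u /=; rewrite /unitary_mx.
    move=> uu; rewrite /g; apply: big1 => i _; apply: big1 => j _.
    by rewrite /d uu subrr mxE /= expr0n addr0.
  move=> g0; apply/eqP; rewrite -subr_eq0; apply/eqP/matrixP => i j.
  have nn i' j' : 0 <= complex.Re (d u i' j') ^+ 2 + complex.Im (d u i' j') ^+ 2.
    by rewrite addr_ge0 ?sqr_ge0.
  have /eqP := g0; rewrite psumr_eq0; last by move=> i' _; exact: sumr_ge0.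
  move=> /allP /(_ i (mem_index_enum _)) /=; rewrite psumr_eq0 //.
  move=> /allP /(_ j (mem_index_enum _)) /=; rewrite paddr_eq0 ?sqr_ge0 // !sqrf_eq0.
  by rewrite [RHS]mxE -/(d u) => /andP[/eqP h1 /eqP h2]; apply/eqP; rewrite eq_complex h1 h2 !eqxx.
have mg : measurable_fun setT g.
  apply: measurable_sum => i; apply: measurable_sum => j.
  by have [m1 m2] := md i j; apply: measurable_funD; exact: measurable_funX.
by apply: mg => //; exact: measurable_set1.
Qed.

End ComplexMeasurable.

Section HaarMean.
Variables (R : realType) (N : nat) (mu : probability (MxT R N) R).
Hypothesis haar_mu : haar mu.
Local Notation C := R[i].
Local Notation T := (MxT R N).
Local Notation U := ([set u | unitary_mx u] : set T).

Definition haar_adm (f : T -> C) :=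
  cmeas f /\ exists M : R, forall u : T, unitary_mx u -> `|f u| <= M%:C.

Definition unitary_indic (u : T) : C := ((\1_U u : R))%:C.

(** Admissible functions such as the inverse of a determinant may be unbounded off the unitary
    matrices. The indicator makes the integrand bounded everywhere, hence integrable, and makes the
    mean depend only on unitary values. *)
Definition haar_mean (f : T -> C) : C := cintegral mu (fun u => unitary_indic u * f u).

Lemma unitary_indicE u : unitary_indic u = if `[<unitary_mx u>] then 1 else 0.
Proof.
rewrite /unitary_indic indicE; case: asboolP => h; first by rewrite mem_set.
by rewrite memNset.
Qed.

Lemma cmeas_unitary_indic : cmeas unitary_indic.
Proof.
split; last by exact: measurable_cst.
by apply: measurable_indic; exact: measurable_unitary.
Qed.

Lemma haar_mean_ext f g : (forall u : T, unitary_mx u -> f u = g u) -> haar_mean f = haar_mean g.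
Proof.
move=> fg; rewrite /haar_mean; congr cintegral; apply/funext => u.
by rewrite unitary_indicE; case: asboolP => [h|_]; rewrite ?mul0r // fg.
Qed.

Lemma Re_cintegral (f : T -> C) : complex.Re (cintegral mu f) = Rintegral mu setT (fun u => complex.Re (f u)).
Proof. by rewrite /cintegral cReD cReM /=; ring. Qed.

Lemma Im_cintegral (f : T -> C) : complex.Im (cintegral mu f) = Rintegral mu setT (fun u => complex.Im (f u)).
Proof. by rewrite /cintegral cImD cImM /=; ring. Qed.

Lemma normc_Re_le (z : C) (M : R) : `|z| <= M%:C -> `|complex.Re z| <= M.
Proof. by move=> h; rewrite -lecR (le_trans (normc_ge_Re z)). Qed.

Lemma normc_Im_le (z : C) (M : R) : `|z| <= M%:C -> `|complex.Im z| <= M.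
Proof.
move=> h; have -> : complex.Im z = - complex.Re (z * 'i%C) by rewrite ReiNIm opprK.
rewrite normrN; apply: normc_Re_le; rewrite normrM.
suff -> : `|'i%C : C| = 1 by rewrite mulr1.
by rewrite normc_def /= expr0n expr1n add0r sqrtr1.
Qed.

(** The indicator changes the integrand only on the complement of the unitary matrices, a null set
    by the first clause of [haar]. *)
Lemma cintegral_haar_mean f : cmeas f -> cintegral mu f = haar_mean f.
Proof.
move=> mf; have [f1 f2] := mf; have [g1 g2] := cmeasM cmeas_unitary_indic mf.
have muU (P : T -> Prop) : (forall u : T, unitary_mx u -> P u) -> {ae mu, forall u : T, P u}.
  move=> UP; exists (~` U); split; [by apply: measurableC; exact: measurable_unitary|exact: haar_mu.1|].
  by move=> u /= nP /UP.
apply/eqP; rewrite eq_complex /haar_mean !Re_cintegral !Im_cintegral; apply/andP; split;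
  apply/eqP; congr fine; apply: ae_eq_integral => //;
  try (by apply/measurable_EFinP);
  by apply: muU => u uU _; rewrite unitary_indicE asboolT // mul1r.
Qed.

Lemma mu_setT : fine (mu setT) = 1.
Proof. by rewrite [X in fine X](_ : _ = 1%E) //; exact: probability_setT. Qed.

Lemma integrable_bounded (g : T -> R) (M : R) :
  measurable_fun setT g -> (forall u, `|g u| <= M) -> mu.-integrable setT (EFin \o g).
Proof.
move=> mg gM; apply: measurable_bounded_integrable => //.
  by rewrite [X in (X < _)%E](_ : _ = 1%E) ?ltry //; exact: probability_setT.
exists M; split; first exact: num_real.
by move=> x Mx u _; exact: le_trans (gM u) (ltW Mx).
Qed.

Lemma haar_adm_bound f : haar_adm f -> exists M : R, forall u, `|unitary_indic u * f u| <= M%:C.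
Proof.
move=> [_ [M fM]]; exists `|M| => u; rewrite unitary_indicE.
case: asboolP => [h|_]; last by rewrite mul0r normr0 lecR.
by rewrite mul1r (le_trans (fM u h)) // lecR ler_norm.
Qed.

Lemma haar_adm_integrable f : haar_adm f ->
  mu.-integrable setT (EFin \o (fun u => complex.Re (unitary_indic u * f u))) /\
  mu.-integrable setT (EFin \o (fun u => complex.Im (unitary_indic u * f u))).
Proof.
move=> af; have [M fM] := haar_adm_bound af; have [m1 m2] := cmeasM cmeas_unitary_indic af.1.
split; apply: (integrable_bounded (M := M)) => // u.
  exact: normc_Re_le.
exact: normc_Im_le.
Qed.

Lemma haar_meanD f g : haar_adm f -> haar_adm g -> haar_mean (fun u => f u + g u) = haar_mean f + haar_mean g.
Proof.
move=> /haar_adm_integrable[f1 f2] /haar_adm_integrable[g1 g2]; apply/eqP.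
rewrite eq_complex (cReD (haar_mean f)) (cImD (haar_mean f)) /haar_mean !Re_cintegral !Im_cintegral -!RintegralD //.
apply/andP; split; apply/eqP; congr Rintegral; apply/funext => u.
  by rewrite mulrDr cReD.
by rewrite mulrDr cImD.
Qed.

Lemma haar_meanZ c f : haar_adm f -> haar_mean (fun u => c * f u) = c * haar_mean f.
Proof.
move=> /haar_adm_integrable[f1 f2]; apply/eqP.
rewrite eq_complex (cReM c (haar_mean f)) (cImM c (haar_mean f)) /haar_mean !Re_cintegral !Im_cintegral -!RintegralZl //.
have iZ r g : mu.-integrable setT (EFin \o g) -> mu.-integrable setT (EFin \o (fun u => r * g u) : T -> \bar R).
  by move=> ig; rewrite (_ : _ \o _ = (fun u => r%:E * (EFin \o g) u)%E) //; exact: integrableZl.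
rewrite -RintegralB ?iZ // -RintegralD ?iZ //.
apply/andP; split; apply/eqP; congr Rintegral; apply/funext => u.
  by rewrite mulrCA cReM.
by rewrite mulrCA cImM.
Qed.

Lemma haar_mean1 : haar_mean (fun=> 1) = 1.
Proof.
have -> : haar_mean (fun=> 1) = cintegral mu (fun=> 1) by rewrite cintegral_haar_mean //; exact: cmeas_cst.
by apply/eqP; rewrite eq_complex Re_cintegral Im_cintegral /= !Rintegral_cst // !mu_setT /= !mulr1 !eqxx.
Qed.

(** The factor 2 comes from bounding real and imaginary parts separately by M; uniform limits are
    insensitive to the constant. *)
Lemma haar_mean_bound f (M : R) : haar_adm f -> (forall u : T, unitary_mx u -> `|f u| <= M%:C) ->
  `|haar_mean f| <= (2 * M)%:C.
Proof.
move=> af fM.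
have M0 : 0 <= M.
  have := fM (1%:M : 'M[C]_N); rewrite /unitary_mx map_mx1 trmx1 mulmx1 => /(_ erefl) h.
  by rewrite -lecR; apply: le_trans h; exact: normr_ge0.
have fM' u : `|unitary_indic u * f u| <= M%:C.
  rewrite unitary_indicE; case: asboolP => [h|_]; first by rewrite mul1r fM.
  by rewrite mul0r normr0 lecR.
have [f1 f2] := haar_adm_integrable af.
have B (g : T -> R) : mu.-integrable setT (EFin \o g) -> (forall u, `|g u| <= M) -> `|Rintegral mu setT g| <= M.
  move=> ig gM; apply: (le_trans (le_normr_Rintegral _ ig)) => //.
  apply: (@le_trans _ _ (Rintegral mu setT (fun=> M))).
    apply: le_Rintegral => //; first exact: integrable_norm.
    by apply: (integrable_bounded (M := M)) => // u; rewrite ger0_norm.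
  by rewrite Rintegral_cst // mu_setT mulr1.
have : `|complex.Re (haar_mean f)| <= M by rewrite Re_cintegral B // => u; exact: normc_Re_le.
have : `|complex.Im (haar_mean f)| <= M by rewrite Im_cintegral B // => u; exact: normc_Im_le.
case: (haar_mean f) => a b /= hb ha; rewrite normc_def lecR /=.
apply: (@le_trans _ _ (Num.sqrt ((`|a| + `|b|) ^+ 2))); last first.
  by rewrite sqrtr_sqr ger0_norm ?addr_ge0 // mulr2n mulrDl mul1r lerD.
rewrite ler_sqrt ?sqr_ge0 // sqrrD !real_normK ?num_real //.
by rewrite lerD2r lerDl mulrn_wge0 // mulr_ge0.
Qed.

Lemma unitary_mul (v w : 'M[C]_N) : unitary_mx v -> unitary_mx w -> unitary_mx (v *m w).
Proof.
rewrite /unitary_mx => hv hw; rewrite map_mxM trmx_mul mulmxA -[v *m w *m _]mulmxA hw.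
by rewrite mulmx1.
Qed.

Lemma unitary_adj (v : 'M[C]_N) : unitary_mx v -> unitary_mx (map_mx conjc v)^T.
Proof.
rewrite /unitary_mx => /mulmx1C hv.
by rewrite [X in _ *m X](_ : _ = v) //; apply/matrixP => i j; rewrite !mxE conjcK.
Qed.

Lemma unitary_left (v w : 'M[C]_N) : unitary_mx v -> unitary_mx (v *m w) -> unitary_mx w.
Proof.
move=> hv hvw; have := unitary_mul (unitary_adj hv) hvw.
by rewrite mulmxA (mulmx1C hv) mul1mx.
Qed.

Lemma measurable_mulmx (v : 'M[C]_N) : measurable_fun setT (fun u : T => (v *m u : T)).
Proof.
apply: (@measurability _ _ T T setT _ (@mx_gen R N)) => // _ [B [i [j [D [mD hB]]]] <-].
have [m1 m2] : cmeas (fun u : T => (v *m (u : 'M[C]_N)) i j).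
  under [X in cmeas X]eq_fun => u do rewrite mxE.
  by apply: cmeas_sum => k; apply: cmeasM; [exact: cmeas_cst|exact: cmeas_entry].
by case: hB => ->; [exact: m1 | exact: m2].
Qed.

(** Change of variables: the pushforward of [mu] under left multiplication agrees with [mu] on
    measurable sets, and the unitary indicator is itself invariant. *)
Lemma haar_mean_left (v : 'M[C]_N) f : unitary_mx v -> haar_adm f -> haar_mean (fun u => f (v *m u)) = haar_mean f.
Proof.
move=> hv af; have [f1 f2] := haar_adm_integrable af; have [m1 m2] := cmeasM cmeas_unitary_indic af.1.
have [M fM] := haar_adm_bound af.
have indicv (u : T) : unitary_indic (v *m u) = unitary_indic u.
  rewrite !unitary_indicE; congr (if _ then _ else _); apply/asboolP/asboolP => h; first exact: unitary_left h.
  exact: unitary_mul.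
have inv (g : T -> R) : measurable_fun setT g -> (forall u, `|g u| <= M) ->
    Rintegral mu setT (fun u : T => g (v *m u)) = Rintegral mu setT g.
  move=> mg gM; rewrite /Rintegral; congr fine.
  have mv := measurable_mulmx v.
  have ig : mu.-integrable ((fun u : T => v *m u : T) @^-1` setT) ((EFin \o g) \o (fun u : T => v *m u : T)).
    rewrite preimage_setT; apply: (@integrable_bounded (fun u : T => g (v *m u)) M) => //.
    exact: measurableT_comp mg mv.
  have mEg : measurable_fun setT (EFin \o g) by apply/measurable_EFinP.
  have := integral_pushforward mv mEg ig measurableT; rewrite preimage_setT => <-.
  by apply: eq_measure_integral => A mA _; exact: (haar_mu.2 v hv A mA).
have Ir := inv _ m1 (fun u => normc_Re_le (fM u)).
have Ii := inv _ m2 (fun u => normc_Im_le (fM u)).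
have e (u : T) : unitary_indic u * f (v *m u) = unitary_indic (v *m u) * f (v *m u) by rewrite indicv.
apply/eqP; rewrite /haar_mean eq_complex !Re_cintegral !Im_cintegral -Ir -Ii.
by apply/andP; split; apply/eqP; congr Rintegral; apply/funext => u; rewrite e.
Qed.

End HaarMean.

Section UnitaryMatrices.
Variables (R : realType) (N : nat).
Local Notation C := R[i].

Lemma unitary_mxE (u : 'M[C]_N) : unitary_mx u -> u \is unitarymx.
Proof.
move=> hu; apply/unitarymxP; rewrite -[RHS]hu; congr (_ *m _).
by apply/matrixP => i j; rewrite !mxE.
Qed.

Lemma unitary_entry_le1 (u : 'M[C]_N) i j : unitary_mx u -> `|u i j| <= 1.
Proof.
move=> hu.
have e : \sum_k u i k * (u i k)^*%C = 1.
  have := congr1 (fun A : 'M[C]_N => A i i) hu; rewrite !mxE eqxx mulr1n => <-.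
  by apply: eq_bigr => k _; rewrite !mxE.
rewrite -(@ler_pXn2r _ 2) ?nnegrE // expr1n sqr_normc -e (bigD1 j) //= lerDl.
by apply: sumr_ge0 => k _; rewrite mulcJ_ge0.
Qed.

End UnitaryMatrices.

Section HaarUnitaryMean.
Variables (R : realType) (N : nat) (mu : probability (MxT R N) R).
Hypothesis haar_mu : haar mu.
Local Notation C := R[i].
Local Notation T := (MxT R N).

Lemma unitary_mxP (u : 'M[C]_N) : unitary_mx u <-> u \is unitarymx.
Proof.
split; first exact: unitary_mxE.
move=> /unitarymxP hu; rewrite /unitary_mx -[RHS]hu; congr (_ *m _).
by apply/matrixP => i j; rewrite !mxE.
Qed.

Lemma normc_realE (z : C) : `|z| = (complex.Re `|z|)%:C.
Proof. by rewrite normc_def. Qed.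

Lemma haar_adm_cst (c : C) : @haar_adm R N (fun=> c).
Proof.
split; first exact: cmeas_cst.
by exists (complex.Re `|c|) => u _; rewrite -normc_realE.
Qed.

Lemma haar_adm_entry i j : @haar_adm R N (fun u => (u : 'M[C]_N) i j).
Proof. by split; [exact: cmeas_entry|exists 1 => u; exact: unitary_entry_le1]. Qed.

Lemma haar_admD f g : @haar_adm R N f -> @haar_adm R N g -> @haar_adm R N (fun u => f u + g u).
Proof.
move=> [mf [M fM]] [mg [L gL]]; split; first exact: cmeasD.
exists (M + L) => u uU; rewrite rmorphD /=; apply: le_trans (ler_normD _ _) _.
by apply: lerD; [exact: fM|exact: gL].
Qed.

Lemma haar_admM f g : @haar_adm R N f -> @haar_adm R N g -> @haar_adm R N (fun u => f u * g u).
Proof.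
move=> [mf [M fM]] [mg [L gL]]; split; first exact: cmeasM.
exists (M * L) => u uU; rewrite rmorphM normrM /=.
by apply: ler_pM; rewrite ?normr_ge0 ?fM ?gL.
Qed.

Lemma haar_adm_conj f : @haar_adm R N f -> @haar_adm R N (fun u => ((f u)^*)%C).
Proof.
move=> [mf [M fM]]; split; first exact: cmeas_conj.
by exists M => u uU; rewrite normcJ fM.
Qed.

Lemma haar_admV f (e : C) : @haar_adm R N f -> 0 < e ->
  (forall u : 'M[C]_N, u \is unitarymx -> e <= `|f u|) -> @haar_adm R N (fun u => (f u)^-1).
Proof.
move=> [mf _] e0 fe; split; first exact: cmeasV.
have eR : e = (complex.Re e)%:C by rewrite RRe_real // gtr0_real.
exists (complex.Re e)^-1 => u /unitary_mxP uU.
have -> : ((complex.Re e)^-1)%:C = e^-1 by rewrite [in RHS]eR fmorphV.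
rewrite normfV.
by rewrite lef_pV2 ?posrE ?fe // (lt_le_trans e0) // fe.
Qed.

Definition haar_unitary_mean : unitary_mean C N.
Proof.
apply: (@UnitaryMean C N (@haar_adm R N) (haar_mean mu)).
- exact: haar_adm_cst.
- exact: haar_adm_entry.
- exact: haar_admD.
- exact: haar_admM.
- exact: haar_adm_conj.
- exact: haar_admV.
- by move=> f [_ [M fM]]; exists M%:C => u /unitary_mxP; exact: fM.
- by move=> f g fg; apply: haar_mean_ext => u /unitary_mxP; exact: fg.
- exact: haar_meanD.
- exact: haar_meanZ.
- exact: haar_mean1.
- by move=> v f /unitary_mxP; exact: haar_mean_left.
move=> f M af fM.
(* The bound is a priori complex. It dominates a norm at the identity matrix, and in the order of
   [R[i]] this forces it to be real. *)
have [MR|] := boolP (M \is Num.real); last first.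
  have /fM : (1%:M : 'M[C]_N) \is unitarymx by apply/unitary_mxP; rewrite /unitary_mx map_mx1 trmx1 mulmx1.
  by move=> h; rewrite ger0_real // (le_trans _ h).
rewrite -(RRe_real MR); have := @haar_mean_bound R N mu f (complex.Re M) af.
rewrite rmorphM /= rmorph_nat; apply => u /unitary_mxP /fM.
by rewrite RRe_real.
(* Transparent, so that [adm] and [mean] of this record compute to [haar_adm] and [haar_mean] in the
   final proof. *)
Defined.

Lemma complex_geom_small (x : C) : `|x| < 1 -> forall e : C, 0 < e -> exists k, `|x| ^+ k < e.
Proof.
move=> x1 e e0.
have eR : e = (complex.Re e)%:C by rewrite RRe_real // gtr0_real.
have xE := normc_realE x; set t := complex.Re _ in xE.
have t1 : t < 1 by rewrite -ltcR -xE.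
have t0 : 0 <= t by rewrite -lecR -xE normr_ge0.
have er : 0 < complex.Re e by rewrite -ltcR -eR.
have nt : `|t| < 1 by rewrite ger0_norm.
have /cvgrPdist_lt /(_ _ er) [K _ hK] := cvg_expr nt.
exists K; rewrite xE eR -rmorphXn ltcR; have := hK K (leqnn K).
by rewrite /= sub0r normrN ger0_norm // exprn_ge0.
Qed.

End HaarUnitaryMean.

(** * The complex exponential and the final formula *)

Section ComplexExponential.
Variable R : realType.
Local Notation C := R[i].

Lemma cexpE (z : C) : cexp z =
  Complex (expR (complex.Re z) * cos (complex.Im z)) (expR (complex.Re z) * sin (complex.Im z)).
Proof. by apply/eqP; rewrite eq_complex /cexp !(cReM, cImM, cReD, cImD) /=; apply/andP; split; apply/eqP; ring. Qed.

Lemma cexpD (z w : C) : cexp (z + w) = cexp z * cexp w.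
Proof.
rewrite !cexpE cReD cImD expRD cosD sinD; apply/eqP.
by rewrite eq_complex cReM cImM /=; apply/andP; split; apply/eqP; ring.
Qed.

Lemma cexp0 : cexp (0 : C) = 1.
Proof. by rewrite cexpE /= expR0 cos0 sin0 mul1r mulr0. Qed.

Lemma cexp_neq0 (z : C) : cexp z != 0.
Proof.
apply/negP => /eqP h; have := cexpD z (- z); rewrite subrr cexp0 h mul0r => /eqP.
by rewrite oner_eq0.
Qed.

Lemma cexpN (z : C) : cexp (- z) = (cexp z)^-1.
Proof.
by apply: (mulfI (cexp_neq0 z)); rewrite -cexpD subrr cexp0 divff // cexp_neq0.
Qed.

Lemma cexpB (z w : C) : cexp (z - w) = cexp z / cexp w.
Proof. by rewrite cexpD cexpN. Qed.

Lemma cexpMn (k : nat) (z : C) : cexp (k%:R * z) = cexp z ^+ k.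
Proof.
elim: k => [|k IH]; first by rewrite mul0r cexp0 expr0.
by rewrite -addn1 natrD mulrDl mul1r cexpD IH addn1 exprSr.
Qed.

Lemma norm_cexp (z : C) : `|cexp z| = (expR (complex.Re z))%:C.
Proof.
by rewrite cexpE normc_def /= !exprMn -mulrDr cos2Dsin2 mulr1 sqrtr_sqr ger0_norm // expR_ge0.
Qed.
End ComplexExponential.

Theorem theorem1p1 (R : realType) (p q N : nat)
  (psi phi : 'I_(p + q) -> R[i])
  (mu : probability (MxT R N) R) :
  (1 <= p)%N -> (1 <= q)%N -> (1 <= N)%N ->
  (forall j : 'I_(p + q), (j < p)%N -> complex.Re (phi j) < 0) ->
  (forall l : 'I_(p + q), (p <= l)%N -> 0 < complex.Re (phi l)) ->
  injective (fun k : 'I_(p + q) => cexp (iC * psi k)) ->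
  haar mu ->
  cintegral mu (fun u : MxT R N =>
    \prod_(k < p + q)
      (\det (1%:M - cexp (iC * psi k) *: (u : 'M[R[i]]_N))
       / \det (1%:M - cexp (phi k) *: (u : 'M[R[i]]_N))))
  = ((p`! * q`!)%:R)^-1 *
    \sum_(w : 'S_(p + q))
      \prod_(l < p + q | (p <= l)%N)
        (cexp (N%:R * (iC * psi (w l))) / cexp (N%:R * phi l) *
         \prod_(j < p + q | (j < p)%N)
           (((1 - cexp (phi j - iC * psi (w l))) *
             (1 - cexp (iC * psi (w j) - phi l))) /
            ((1 - cexp (iC * psi (w j) - iC * psi (w l))) *
             (1 - cexp (phi j - phi l))))).
Proof.
case: N mu => [|n] nu; first by [].
move=> p1 q1 _ phi_neg phi_pos psi_inj haar_nu.
pose m := haar_unitary_mean haar_nu.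
pose a k := cexp (iC * psi k); pose c k := cexp (phi k).
pose B : {set 'I_(p + q)} := finset (fun l : 'I_(p + q) => (p <= l)%N).
have a0 k : a k != 0 by exact: cexp_neq0.
have c_small j : j \notin B -> `|c j| < 1.
  rewrite inE -ltnNge => jp; rewrite norm_cexp -[1]/(1%:C) ltcR.
  by rewrite -expR0 ltr_expR phi_neg.
have c_large l : l \in B -> 1 < `|c l|.
  rewrite inE => pl; rewrite norm_cexp -[1]/(1%:C) ltcR.
  by rewrite -[1]expR0 ltr_expR phi_pos.
have cB : #|B| = q.
  rewrite (_ : B = imset (@rshift p q) (mem predT)).
    by rewrite card_imset; [exact: card_ord|exact: rshift_inj].
  apply/setP => l; rewrite inE; apply/idP/imsetP => [pl|[i _ ->]]; last by rewrite leq_addr.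
  by case: (split_ordP l) pl => i -> /=; [rewrite leqNgt ltn_ord|exists i].
have af := adm_ratio m a c_small c_large.
rewrite (cintegral_haar_mean haar_nu af.1).
transitivity (mean m (fun u => \prod_k (\det (1%:M - a k *: u) / \det (1%:M - c k *: u)))) => //.
rewrite (mean_ratio m (@complex_geom_small R) psi_inj a0 c_small c_large).
pose G S := ratio_term n a c B S.
(* Each subset of size q is the image of [B] under q! p! permutations, whence the prefactor of the
   statement. *)
have := sum_perm_imset B G; rewrite cB card_ord addnK mulnC => e.
rewrite [X in _ = _ * X](_ : _ = \sum_(w : 'S_(p + q)) G (imset w (mem B))).
  by rewrite e -[X in _ * X]mulr_natl mulKf // pnatr_eq0 -lt0n muln_gt0 !fact_gt0.
apply: eq_bigr => w _; rewrite /G ratio_term_perm.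
apply: eq_big => [l|l _]; first by rewrite inE.
rewrite !cexpMn; congr (_ * _); apply: eq_big => [j|j _]; first by rewrite !inE ltnNge.
by rewrite !cexpB.
Qed.
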